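(* Let $\frac{4}{3}<p<4$. For every fixed $w_2\in\mathbb{D}$, the Bergman projection $\mathcal{B}_{\mathbb{D}}: L^p(\mathbb{D},|w_1-w_2|^{2-p})\to L^p(\mathbb{D},|w_1-w_2|^{2-p})$ is bounded, where $|w_1-w_2|^{2-p}$ is regarded as a weight function of $w_1\in\mathbb{D}$. Moreover, its norm is bounded by a constant independent of $w_2\in\mathbb{D}$.
   Context: $\mathbb{D}$ is the open unit disk in $\mathbb{C}$. For a weight $\sigma>0$ (defined a.e.) on $\mathbb{D}$, $L^p(\mathbb{D},\sigma)$ has norm $\left(\int_{\mathbb{D}}|f|^p\sigma\,dA\right)^{1/p}$, where $dA$ is Lebesgue area measure. The Bergman projection of $\mathbb{D}$ is $$\mathcal{B}_{\mathbb{D}}(f)(w)=\int_{\mathbb{D}}B(w,\eta)\,f(\eta)\,dA(\eta),\qquad B(w,\eta)=\frac{1}{\pi(1-w\bar\eta)^2}.$$ *)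

(* Defs.v *)
From HB Require Import structures.
From mathcomp Require Import all_boot all_order all_algebra.
From mathcomp Require Import complex.
From mathcomp Require Import all_classical all_reals all_analysis.
Set Implicit Arguments.
Unset Strict Implicit.
Unset Printing Implicit Defensive.
Import Order.TTheory GRing.Theory Num.Theory.
Import numFieldNormedType.Exports.
Local Open Scope classical_set_scope.
Local Open Scope ring_scope.
Local Open Scope complex_scope.

Local Notation plane R := (measurableTypeR R * measurableTypeR R)%type.

(* No measure is installed on R[i]: C is identified with R^2 through
   (x, y) |-> x + iy, and everything is pulled back along this map. *)
Definition cplx {R : realType} (z : plane R) : R[i] := z.1 +i* z.2.

Definition area {R : realType} : set (plane R) -> \bar R :=
  (@lebesgue_measure R \x @lebesgue_measure R)%E.

HB.instance Definition _ (R : realType) := Measure.on (@area R).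

(* The modulus as a real number (`|z| itself has type R[i]). *)
Definition cabs {R : realType} (z : R[i]) : R := complex.Re `|z|.

Definition unit_disk {R : realType} : set R[i] := [set z | cabs z < 1].

Definition cmeasurable_fun {R : realType} (D : set R[i]) (f : R[i] -> R[i]) :=
  measurable_fun (cplx @^-1` D) (fun z => complex.Re (f (cplx z))) /\
  measurable_fun (cplx @^-1` D) (fun z => complex.Im (f (cplx z))).

Definition cintegrable {R : realType} (D : set R[i]) (f : R[i] -> R[i]) :=
  (@area R).-integrable (cplx @^-1` D) (fun z => (complex.Re (f (cplx z)))%:E) /\
  (@area R).-integrable (cplx @^-1` D) (fun z => (complex.Im (f (cplx z)))%:E).

(* Meaningful only when cintegrable D f holds. *)
Definition cintegral {R : realType} (D : set R[i]) (f : R[i] -> R[i]) : R[i] :=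
  Rintegral (@area R) (cplx @^-1` D) (fun z => complex.Re (f (cplx z)))
  +i* Rintegral (@area R) (cplx @^-1` D) (fun z => complex.Im (f (cplx z))).

Definition weighted_norm {R : realType} (p : R) (sigma : R[i] -> R)
    (f : R[i] -> R[i]) : \bar R :=
  ((\int[area]_(z in cplx @^-1` unit_disk)
     (cabs (f (cplx z)) `^ p * sigma (cplx z))%:E) `^ p^-1)%E.

Definition in_Lp {R : realType} (p : R) (sigma : R[i] -> R)
    (f : R[i] -> R[i]) :=
  cmeasurable_fun unit_disk f /\ (weighted_norm p sigma f < +oo)%E.

Definition bergman_kernel {R : realType} (w eta : R[i]) : R[i] :=
  ((pi : R)%:C * (1 - w * eta^*) ^+ 2)^-1.

Definition bergman {R : realType} (f : R[i] -> R[i]) (w : R[i]) : R[i] :=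
  cintegral unit_disk (fun eta => bergman_kernel w eta * f eta).

(* As 0 `^ a = 0 for a != 0, when p > 2 the weight has the value 0 (not +oo)
   at the single point w1 = w2, a null set. *)
Definition dist_weight {R : realType} (p : R) (w2 w1 : R[i]) : R :=
  cabs (w1 - w2) `^ (2 - p).

Definition bergman_defined_on_Lp {R : realType} (p : R) (sigma : R[i] -> R) :=
  forall f, in_Lp p sigma f -> forall w, unit_disk w ->
    cintegrable unit_disk (fun eta => bergman_kernel w eta * f eta).

Definition bounded_on_Lp {R : realType} (p : R) (sigma : R[i] -> R)
    (T : (R[i] -> R[i]) -> (R[i] -> R[i])) :=
  (forall f, in_Lp p sigma f -> in_Lp p sigma (T f)) /\
  exists C : R, forall f, in_Lp p sigma f ->
    (weighted_norm p sigma (T f) <= C%:E * weighted_norm p sigma f)%E.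

Definition operator_norm {R : realType} (p : R) (sigma : R[i] -> R)
    (T : (R[i] -> R[i]) -> (R[i] -> R[i])) : \bar R :=
  ereal_sup [set weighted_norm p sigma (T f) | f in
    [set f | in_Lp p sigma f /\ (weighted_norm p sigma f <= 1)%E]].

(* Main.v *)
Require Import Defs.
From HB Require Import structures.
From mathcomp Require Import all_boot all_order all_algebra.
From mathcomp Require Import complex.
From mathcomp Require Import all_classical all_reals all_analysis.
From mathcomp Require Import measurable_realfun.
From mathcomp Require Import ring lra.
Set Implicit Arguments.
Unset Strict Implicit.
Unset Printing Implicit Defensive.
Import Order.TTheory GRing.Theory Num.Theory.
Import numFieldNormedType.Exports.
Local Open Scope ring_scope.

(** Schur's test for the positive kernel 1/|1 - w z^*|^2, with test function
    H(z) = |z - a|^(-q1) (1 - |z|^2)^(-u).  With q1 = max(0, (2-p)/(p-1)) and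
    q2 = max(p-2, 0) both hypotheses of the test follow from the single estimate
      int_D |z-a|^(-q) (1-|z|^2)^(-u) / |1 - w z^*|^2 dA(z)
        <= C |w-a|^(-q) (1-|w|^2)^(-u),   0 <= q < 2, 0 < u < min(1, 2-q),
    uniformly in a and w; here q1, q2 < 2 means exactly 4/3 < p < 4.
    Where |z-a| >= |w-a|/2 this is the unweighted (Forelli-Rudin) case q = 0;
    where |z-a| < |w-a|/2 one has |1 - w z^*| >= |z-w| >= |w-a|/2, and a local
    integral of |z-a|^(-q) (1-|z|^2)^(-u) remains.
    No polar coordinates are needed: on {y^2 <= 1/2} one has
    1 - |z|^2 >= T/2 with T = sqrt(1-y^2) - |x|, so all integrands are dominated
    by functions of x - c (c one of finitely many points) and y, and Tonelli
    reduces everything to one-variable integrals; {x^2 <= 1/2} is symmetric. *)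

(** The second hypothesis of the test concerns sigma H^(p-1) with sigma = |z-a|^(2-p). This equals
    |z-a|^(-q2) (1-|z|^2)^(-u(p-1)) exactly when q2 = p - 2 + q1 (p-1); that relation lets one
    estimate serve twice, and q1 is the least value for which q1, q2 >= 0. The obstacle lies in the
    local integral when a is near the circle, where the singularities at a and on the boundary
    interact. With r = |w-a|, scaling yields r^(-q-u) in place of r^(-q) (1-|w|^2)^(-u). This
    suffices if 1-|w|^2 < 8r. Otherwise 1-|z|^2 is comparable to 1-|w|^2 for |z-a| < r/2, so the
    factor with exponent u comes out of the integral and the local bound is used with u = 0. The
    test bounds norms, but the integral must also converge at every single w, including w = a. For
    fixed w the kernel is bounded, so this reduces to the integrability of f on the disk, which
    again follows from the test function. Since a negative power of 0 is 0, pointwise bounds break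
    down at singular points; these are removed as null sets. *)

(** * Improper integrals on the line through primitives *)

Section RealLine.
Local Open Scope classical_set_scope.
Local Open Scope ring_scope.
Context {R : realType}.
Implicit Types (f F g G : R -> R) (c e u t A M : R).
Local Notation mu := (@lebesgue_measure R).

Lemma is_derive_continuous g (x dg : R) : is_derive x 1 g dg -> {for x, continuous g}.
Proof.
by move=> h; apply: differentiable_continuous; apply/derivable1_diffP; case: h.
Qed.

Lemma is_derive_subr c (x : R) : is_derive x 1 (fun y : R => y - c) 1.
Proof. by apply: DeriveDef => //; rewrite derive_val subr0. Qed.

Lemma is_derive_subl c (x : R) : is_derive x 1 (fun y : R => c - y) (-1).
Proof. by have := is_deriveB (is_derive_cst c x 1) (is_derive_id x 1); rewrite sub0r. Qed.

(** Monotone convergence along compact intervals reduces the improper integral to the fundamental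
    theorem of calculus. Only increments of [G] are bounded, so no limit at the ends of the union
    has to be computed. *)
Lemma le_integral_bigcup_primitive g G (alpha beta : R^nat) M :
  measurable_fun setT g -> (forall x, 0 <= g x) ->
  (forall n, alpha n < beta n) ->
  (forall n, alpha n.+1 <= alpha n) -> (forall n, beta n <= beta n.+1) ->
  (forall n x, x \in `[alpha n, beta n] -> is_derive x 1 G (g x)) ->
  (forall n x, x \in `[alpha n, beta n] -> {for x, continuous g}) ->
  (forall n, G (beta n) - G (alpha n) <= M) ->
  (\int[mu]_(x in \bigcup_n `[alpha n, beta n]%classic) (g x)%:E <= M%:E)%E.
Proof.
move=> mg g0 ab da ib dG cg GM.
have mgE (D : set R) : measurable_fun D (EFin \o g).
  by apply/measurable_EFinP; exact: measurable_funTS.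
have mono : nondecreasing_seq (fun n => `[alpha n, beta n]%classic).
  apply/nondecreasing_seqP => n; rewrite subsetEset => x /=.
  rewrite !in_itv/= => /andP[h1 h2]; apply/andP; split.
    exact: le_trans h1.
  exact: le_trans (ib n).
rewrite -(cvg_lim _ (@ge0_nondecreasing_set_cvg_integral _ (measurableTypeR R) R
  (fun n => `[alpha n, beta n]%classic) (EFin \o g) mu mono _ _ _)) //; last first.
  by move=> n x _; rewrite lee_fin.
  by move=> i; exact: mgE.
apply: lime_le.
  apply: ereal_nondecreasing_is_cvgn.
  apply: (@ge0_nondecreasing_set_nondecreasing_integral _ (measurableTypeR R) R _ (EFin \o g)) => //.
    by move=> n; exact: mgE.
  by move=> n x _; rewrite lee_fin.
apply: nearW => n /=.
rewrite (@continuous_FTC2 R g G)//.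
- by rewrite -EFinB lee_fin.
- apply: continuous_in_subspaceT => x xab; apply: (cg n); move: xab.
  by rewrite inE.
- split.
  + move=> x xab; have [|//] := dG n x.
    exact: subset_itv_oo_cc.
  + apply: cvg_at_right_filter; apply: (@is_derive_continuous _ _ (g (alpha n))).
    by apply: (dG n); rewrite in_itv/= lexx ltW.
  + apply: cvg_at_left_filter; apply: (@is_derive_continuous _ _ (g (beta n))).
    by apply: (dG n); rewrite in_itv/= lexx ltW.
- move=> x xab; rewrite derive1E.
  have h := dG n x (subset_itv_oo_cc xab).
  by rewrite derive_val.
Qed.

Lemma setT_bigcup_away c : [set: R] =
  (\bigcup_n `[c + n.+1%:R^-1, c + n.+2%:R]%classic `|`
   \bigcup_n `[c - n.+2%:R, c - n.+1%:R^-1]%classic) `|` [set c].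
Proof.
have key t : 0 < t -> exists n : nat, n.+1%:R^-1 <= t <= n.+2%:R.
  (* For this [n], [n.+1] exceeds both t and 1/t. The right end [n.+2] keeps the interval for n = 0
     from degenerating to the point at distance 1. *)
  move=> t0; exists (Num.trunc (t + t^-1)).
  have := truncnS_gt (t + t^-1); set m := Num.trunc _.
  have ti : 0 < t^-1 by rewrite invr_gt0.
  move=> h; apply/andP; split.
    by rewrite -[leRHS]invrK lef_pV2 ?posrE// ltW// (lt_trans _ h)// ltrDr.
  have : m.+1%:R <= m.+2%:R :> R by rewrite ler_nat.
  lra.
apply/esym/seteqP; split=> // x _.
case: (ltgtP x c) => [xc|xc|->]; last by right.
- left; right; have [|n /andP[h1 h2]] := key (c - x); first by rewrite subr_gt0.
  by exists n => //=; rewrite in_itv/= lerBlDr -lerBlDl h2 lerBrDr -lerBrDl.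
- left; left; have [|n /andP[h1 h2]] := key (x - c); first by rewrite subr_gt0.
  by exists n => //=; rewrite in_itv/=; 
  by rewrite -lerBrDl h1 -lerBlDl h2.
Qed.

(** Each side of [c] contributes at most [M]. Derivative and continuity are asked for t > 0 only, so
    [f] may be singular at 0; the point [c] is a null set. *)
Lemma le_integral_dist f F M c :
  measurable_fun setT f -> (forall t, 0 <= f t) ->
  (forall t, 0 < t -> is_derive t 1 F (f t)) ->
  (forall t, 0 < t -> {for t, continuous f}) ->
  (forall s t : R, 0 < s -> s < t -> F t - F s <= M) ->
  (\int[mu]_x (f `|x - c|)%:E <= (M + M)%:E)%E.
Proof.
move=> mf f0 dF cf FM.
have mg : measurable_fun setT (fun x : R => f `|x - c|).
  apply: measurableT_comp => //; apply: measurableT_comp => //.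
  exact: measurable_funB.
have mgE (D : set R) : measurable_fun D (fun x : R => (f `|x - c|)%:E).
  by apply/measurable_EFinP; exact: measurable_funTS.
rewrite (setT_bigcup_away c); set P := \bigcup_n _; set Q := \bigcup_n _.
have mP : measurable P by apply: bigcup_measurable.
have mQ : measurable Q by apply: bigcup_measurable.
have Pc x : P x -> c < x.
  move=> [n _] /=; rewrite in_itv/= => /andP[h _]; apply: lt_le_trans h.
  by rewrite ltrDl invr_gt0.
have Qc x : Q x -> x < c.
  move=> [n _] /=; rewrite in_itv/= => /andP[_ h]; apply: le_lt_trans h _.
  by rewrite gtrDl oppr_lt0 invr_gt0.
rewrite (@ge0_negligible_integral _ (measurableTypeR R) R mu _ [set c])//; last 4 first.
- by apply: measurableU; [exact: measurableU|exact: measurable_set1].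
- exact: mgE.
- by move=> x _; rewrite lee_fin.
- exact: lebesgue_measure_set1.
have -> : (P `|` Q `|` [set c]) `\` [set c] = P `|` Q.
  apply/seteqP; split=> [x [[//|/=->]]//|x PQ]; split; first by left.
  by move=> /= xc; case: PQ => [/Pc|/Qc]; rewrite xc ltxx.
rewrite ge0_integral_setU//; last 3 first.
- exact: mgE.
- by move=> x _; rewrite lee_fin.
- rewrite disj_set2E; apply/eqP; rewrite -subset0 => x [/Pc h /Qc].
  by move=> /(lt_trans h); rewrite ltxx.
rewrite EFinD leeD//.
- have -> : (\int[mu]_(x in P) (f `|x - c|)%:E = \int[mu]_(x in P) (f (x - c))%:E)%E.
    apply: eq_integral => x; rewrite inE => /Pc h; by rewrite ger0_norm// subr_ge0 ltW.
  have n1 n : 0 < n.+1%:R^-1 :> R by rewrite invr_gt0.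
  have mono n : n.+2%:R^-1 <= n.+1%:R^-1 :> R by rewrite lef_pV2 ?posrE// ler_nat.
  have le1 n : n.+1%:R^-1 < n.+2%:R :> R.
    apply: (@le_lt_trans _ _ 1); last by rewrite ltr1n.
    by rewrite invf_le1 // ler1n.
  apply: (@le_integral_bigcup_primitive (fun x : R => f (x - c)) (fun x : R => F (x - c)) (fun n => c + n.+1%:R^-1)) => //.
  + by apply: measurableT_comp => //; exact: measurable_funB.
  + by move=> n; rewrite ltrD2l.
  + by move=> n; rewrite lerD2l.
  + by move=> n; rewrite lerD2l ler_nat.
  + move=> n x; rewrite in_itv/= => /andP[h _].
    have xc : 0 < x - c by rewrite subr_gt0 (lt_le_trans _ h)// ltrDl.
    have := @is_derive1_comp _ F (fun x : R => x - c) x (f (x - c)) 1 (dF _ xc) _.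
    by rewrite mulr1; apply; exact: is_derive_subr.
  + move=> n x; rewrite in_itv/= => /andP[h _].
    have xc : 0 < x - c by rewrite subr_gt0 (lt_le_trans _ h)// ltrDl.
    apply: (@continuous_comp _ _ _ (fun x : R => x - c)); last exact: cf.
    by exact: (is_derive_continuous (is_derive_subr _ _)).
  + have e y : c + y - c = y by rewrite addrAC subrr add0r.
    by move=> n; rewrite !e; exact: FM.
- have -> : (\int[mu]_(x in Q) (f `|x - c|)%:E = \int[mu]_(x in Q) (f (c - x))%:E)%E.
    apply: eq_integral => x; rewrite inE => /Qc h; by rewrite distrC ger0_norm// subr_ge0 ltW.
  have n1 n : 0 < n.+1%:R^-1 :> R by rewrite invr_gt0.
  have mono n : n.+2%:R^-1 <= n.+1%:R^-1 :> R by rewrite lef_pV2 ?posrE// ler_nat.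
  have le1 n : n.+1%:R^-1 < n.+2%:R :> R.
    apply: (@le_lt_trans _ _ 1); last by rewrite ltr1n.
    by rewrite invf_le1 // ler1n.
  apply: (@le_integral_bigcup_primitive (fun x : R => f (c - x)) (fun x : R => - F (c - x)) (fun n => c - n.+2%:R) (fun n => c - n.+1%:R^-1)) => //.
  + by apply: measurableT_comp => //; exact: measurable_funB.
  + by move=> n; rewrite ltrD2l ltrN2.
  + by move=> n; rewrite lerD2l lerN2 ler_nat.
  + by move=> n; rewrite lerD2l lerN2.
  + move=> n x; rewrite in_itv/= => /andP[_ h].
    have xc : 0 < c - x by rewrite subr_gt0 (le_lt_trans h)// gtrDl oppr_lt0.
    have := @is_derive1_comp _ F (fun x : R => c - x) x (f (c - x)) (-1) (dF _ xc) _.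
    rewrite mulrN1 => H.
    have := @is_deriveN _ _ _ (fun x : R => F (c - x)) x 1 (- f (c - x)) (H _).
    by rewrite opprK; apply; exact: is_derive_subl.
  + move=> n x; rewrite in_itv/= => /andP[_ h].
    have xc : 0 < c - x by rewrite subr_gt0 (le_lt_trans h)// gtrDl oppr_lt0.
    apply: (@continuous_comp _ _ _ (fun x : R => c - x)); last exact: cf.
    by exact: (is_derive_continuous (is_derive_subl _ _)).
  + have e y : c - (c - y) = y by rewrite opprB addrC subrK.
    by move=> n; rewrite !e opprK addrC; exact: FM.
Qed.

End RealLine.

(** * The two model integrals in one variable *)

Section Kernels1D.
Local Open Scope classical_set_scope.
Local Open Scope ring_scope.
Context {R : realType}.
Implicit Types (c e u A r t x y z : R).
Local Notation mu := (@lebesgue_measure R).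

Lemma le0_ler_powR r x y : r <= 0 -> 0 < x -> x <= y -> y `^ r <= x `^ r.
Proof.
move=> r0 x0 xy; rewrite -(opprK r) !(powRN _ (- r)).
have y0 := lt_le_trans x0 xy.
rewrite lef_pV2 ?posrE ?powR_gt0//.
by apply: ge0_ler_powR; rewrite ?oppr_ge0 ?nnegrE ?(ltW x0) ?(ltW y0).
Qed.

Lemma powRD_gt0 r s x : 0 < x -> x `^ (r + s) = x `^ r * x `^ s.
Proof. by move=> x0; rewrite powRD// (gt_eqF x0) implybT. Qed.

Lemma powRNK r x : 0 < x -> x `^ r * x `^ (- r) = 1.
Proof. by move=> x0; rewrite powRN divff// gt_eqF// powR_gt0. Qed.

Lemma measurable_powR_comp d (T : measurableType d) (D : set T) (f : T -> R) r :
  measurable_fun D f -> measurable_fun D (fun w => f w `^ r).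
Proof. by move=> mf; apply: (measurableT_comp (measurable_powR r)). Qed.

Lemma continuous_powR r x : 0 < x -> {for x, continuous (fun y => y `^ r)}.
Proof. by move=> x0; exact: (is_derive_continuous (is_derive1_powR r x0)). Qed.

Lemma is_derive_powR_addl A r t : 0 < A + t ->
  is_derive t 1 (fun s => (A + s) `^ r) (r * (A + t) `^ (r - 1)).
Proof.
move=> At0.
have dA : is_derive t 1 (fun s => A + s) 1.
  by have := is_deriveD (is_derive_cst A t 1) (is_derive_id t 1); rewrite add0r.
have := @is_derive1_comp _ (fun s => s `^ r) (fun s => A + s) t _ _
  (is_derive1_powR r At0) dA.
by rewrite mulr1.
Qed.

(** The primitive -(A+t)^(-u)/u has increments at most A^(-u)/u on t > 0. *)
Lemma integral_powR_tail_le A u c : 0 < u -> 0 < A ->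
  (\int[mu]_x ((A + `|x - c|) `^ (- 1 - u))%:E <= (2 / u * A `^ (- u))%:E)%E.
Proof.
move=> u0 A0.
pose M := u^-1 * A `^ (- u).
have -> : 2 / u * A `^ (- u) = M + M by rewrite /M; ring.
apply: (@le_integral_dist _ (fun t => (A + t) `^ (- 1 - u))
   (fun t => - u^-1 * (A + t) `^ (- u))).
- apply: measurable_powR_comp; exact: measurable_funD.
- by move=> t; exact: powR_ge0.
- move=> t t0; have At0 : 0 < A + t by exact: addr_gt0.
  have := @is_deriveZ _ _ _ _ (- u^-1) _ _ _ (is_derive_powR_addl (- u) At0).
  rewrite /GRing.scale/= mulrA mulrNN mulVf ?gt_eqF// mul1r.
  by rewrite (addrC (- u)).
- move=> t t0; have At0 : 0 < A + t by exact: addr_gt0.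
  exact: (is_derive_continuous (is_derive_powR_addl _ At0)).
- move=> s t s0 st; rewrite !mulNr opprK /M.
  have : 0 <= u^-1 * (A + t) `^ (- u).
    by rewrite mulr_ge0 ?powR_ge0// invr_ge0 ltW.
  have : u^-1 * (A + s) `^ (- u) <= u^-1 * A `^ (- u).
    apply: ler_wpM2l; first by rewrite invr_ge0 ltW.
    by apply: le0_ler_powR; rewrite ?oppr_le0 ?(ltW u0)// lerDl ltW.
  lra.
Qed.

Lemma integral_powR_kernel_le A e c : 0 <= e -> e < 1 -> 0 < A ->
  (\int[mu]_x (`|x - c| `^ (- e) * (A + `|x - c|) `^ (- 2))%:E
    <= (2 / (1 - e) * A `^ (- 1 - e))%:E)%E.
Proof.
move=> e0 e1 A0.
have e1' : 0 < 1 - e by lra.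
(* h^(1-e) is bounded by 1 and its derivative (1-e) h^(-e) A (A+t)^(-2)
     dominates a multiple of the integrand. *)
pose h t : R := t * (A + t) `^ (- 1).
pose f t : R := (1 - e) * h t `^ (- e) * (A * (A + t) `^ (- 2)).
have h01 t : 0 < t -> 0 < h t <= 1.
  move=> t0; have At0 : 0 < A + t by exact: addr_gt0.
  rewrite /h mulr_gt0 ?powR_gt0//= powR_inv1 ?(ltW At0)//.
  by rewrite ler_pdivrMr// mul1r lerDr ltW.
have dh t : 0 < t -> is_derive t 1 h (A * (A + t) `^ (- 2)).
  move=> t0; have At0 : 0 < A + t by exact: addr_gt0.
  have := is_deriveM (is_derive_id t 1) (is_derive_powR_addl (- 1) At0).
  rewrite /GRing.scale/= (_ : - 1 - 1 = - 2 :> R); last by ring.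
  rewrite (_ : t * _ + _ = A * (A + t) `^ (- 2))// mulr1.
  rewrite (_ : - 1 = - 2 + 1 :> R); last by ring.
  rewrite powRD_gt0// powRr1 ?(ltW At0)//; ring.
have mh : measurable_fun setT h.
  apply: measurable_funM => //; apply: measurable_powR_comp; exact: measurable_funD.
have mf : measurable_fun setT f.
  apply: measurable_funM; apply: measurable_funM => //; apply: measurable_powR_comp => //.
  exact: measurable_funD.
have f0 t : 0 <= f t by rewrite /f !mulr_ge0 ?powR_ge0 ?(ltW A0)// ltW.
have dF t : 0 < t -> is_derive t 1 (fun s => h s `^ (1 - e)) (f t).
  move=> t0; have /andP[ht0 _] := h01 t t0.
  have := @is_derive1_comp _ (fun s => s `^ (1 - e)) h t _ _
    (is_derive1_powR (1 - e) ht0) (dh _ t0).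
  by rewrite /f addrAC subrr add0r.
have cf t : 0 < t -> {for t, continuous f}.
  move=> t0; have At0 : 0 < A + t by exact: addr_gt0.
  have /andP[ht0 _] := h01 t t0.
  have c1 : {for t, continuous (fun s => h s `^ (- e))}.
    apply: (@continuous_comp _ _ _ h (fun y => y `^ (- e))); last exact: continuous_powR.
    exact: (is_derive_continuous (dh _ t0)).
  have c2 := is_derive_continuous (is_derive_powR_addl (- 2) At0).
  by apply: (cvgM (cvgM (cvg_cst (1 - e)) c1) (cvgM (cvg_cst A) c2)).
have FM s t : 0 < s -> s < t -> h t `^ (1 - e) - h s `^ (1 - e) <= 1.
  move=> s0 st; have /andP[ht0 ht1] := h01 t (lt_trans s0 st).
  have : h t `^ (1 - e) <= 1 `^ (1 - e).
    by apply: ge0_ler_powR; rewrite ?nnegrE ?(ltW ht0) ?(ltW e1').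
  by rewrite powR1 lerBlDr => /le_trans; apply; rewrite lerDl powR_ge0.
have If := le_integral_dist c mf f0 dF cf FM.
have mft : measurable_fun setT (fun x : R => f `|x - c|).
  apply: measurableT_comp => //; apply: measurableT_comp => //.
  exact: measurable_funB.
pose K := (1 - e)^-1 * A `^ (- 1 - e).
have K0 : 0 <= K by rewrite mulr_ge0 ?powR_ge0// invr_ge0 ltW.
apply: (@le_trans _ _ (\int[mu]_x (K%:E * (f `|x - c|)%:E))%E); last first.
  rewrite ge0_integralZl_EFin//; last 2 first.
  - by move=> x _; rewrite lee_fin.
  - exact/measurable_EFinP.
  apply: (@le_trans _ _ (K%:E * (1 + 1)%:E)%E); first by rewrite lee_wpmul2l// lee_fin.
  by rewrite -EFinM lee_fin (_ : K * (1 + 1) = 2 / (1 - e) * A `^ (- 1 - e))// /K; ring.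
apply: ge0_le_integral => //.
- by move=> x _; rewrite lee_fin mulr_ge0// powR_ge0.
- apply/measurable_EFinP/measurable_funM; apply: measurable_powR_comp.
    by apply: measurableT_comp => //; exact: measurable_funB.
  by apply: measurable_funD => //; apply: measurableT_comp => //; exact: measurable_funB.
- by apply/measurable_EFinP/measurable_funM.
move=> x _; rewrite -EFinM lee_fin.
move: `|x - c| (normr_ge0 (x - c)) => t t0.
have At0 : 0 < A + t by exact: ltr_wpDr.
rewrite /f /K powRM// ?powR_ge0// -powRrM mulrNN mul1r.
have -> : A `^ (- 1 - e) = A `^ (- 1) * A `^ (- e).
  by rewrite powRD_gt0.
rewrite powR_inv1 ?(ltW A0)//.
set a := A `^ (- e); set b := (A + t) `^ e; set X := t `^ _; set Y := _ `^ (- 2).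
have XY : 0 <= X * Y by rewrite mulr_ge0// powR_ge0.
(* The dominating function is the integrand times ((A+t)/A)^e, a factor at least 1. *)
have -> : (1 - e)^-1 * (A^-1 * a) * ((1 - e) * (X * b) * (A * Y)) = (a * b) * (X * Y).
  by field; rewrite !gt_eqF.
rewrite ler_peMl//; apply: (@le_trans _ _ (A `^ e * a)); first by rewrite powRNK.
rewrite mulrC ler_wpM2l ?powR_ge0//.
by apply: ge0_ler_powR; rewrite ?nnegrE ?(ltW A0) ?(ltW At0)// lerDl.
Qed.

End Kernels1D.

(** * Tonelli on the unit disk *)

Section Plane.
Local Open Scope classical_set_scope.
Local Open Scope ring_scope.
Context {R : realType}.
Implicit Types (c e u A r : R).
Local Notation leb := (@lebesgue_measure R).
Local Notation RT := (measurableTypeR R).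
Local Notation plane := (RT * RT)%type.

(** The exceptional point is one where a distance vanishes: there the negative power in the upper
    bound takes the value 0, and the comparison may fail. *)
Lemma le_integral_off c (S : set RT) (f1 f2 : RT -> \bar R) :
  measurable S -> measurable_fun setT f1 -> measurable_fun setT f2 ->
  (forall x, 0 <= f1 x)%E -> (forall x, 0 <= f2 x)%E ->
  (forall x, S x -> x <> c -> f1 x <= f2 x)%E ->
  (\int[leb]_(x in S) f1 x <= \int[leb]_x f2 x)%E.
Proof.
move=> mS mf1 mf2 f10 f20 f12.
have mc : measurable ([set c] : set RT) by exact: measurable_set1.
rewrite (ge0_negligible_integral mc mS)//; last 2 first.
- exact: measurable_funTS.
- exact: lebesgue_measure_set1.
have mSc : measurable (S `\` [set c]) by exact: measurableD.
apply: (@le_trans _ _ (\int[leb]_(x in S `\` [set c]) f2 x)%E).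
  apply: ge0_le_integral => //; try exact: measurable_funTS.
  by move=> x [Sx xc]; apply: f12.
exact: ge0_subset_integral.
Qed.

Lemma measurable_lt_set d (T : measurableType d) (f : T -> R) c :
  measurable_fun setT f -> measurable [set z | f z < c].
Proof.
move=> mf; rewrite -[X in measurable X]setTI.
have -> : [set z | f z < c] = f @^-1` `]-oo, c[.
  by apply/seteqP; split => z /=; rewrite in_itv.
exact: mf.
Qed.

Lemma measurable_le_set d (T : measurableType d) (f : T -> R) c :
  measurable_fun setT f -> measurable [set z | f z <= c].
Proof.
move=> mf; rewrite -[X in measurable X]setTI.
have -> : [set z | f z <= c] = f @^-1` `]-oo, c].
  by apply/seteqP; split => z /=; rewrite in_itv.
exact: mf.
Qed.

Lemma integralZl_le d (T : measurableType d) (mu : {measure set T -> \bar R})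
    (D : set T) (f : T -> R) (K B : R) :
  measurable D -> measurable_fun D f -> (forall x, 0 <= f x) -> 0 <= K ->
  (\int[mu]_(x in D) (f x)%:E <= B%:E)%E ->
  (\int[mu]_(x in D) (K * f x)%:E <= (K * B)%:E)%E.
Proof.
move=> mD mf f0 K0 fB; under eq_integral do rewrite EFinM.
rewrite ge0_integralZl_EFin//; last 2 first.
- by move=> x _; rewrite lee_fin.
- exact/measurable_EFinP.
by rewrite EFinM lee_wpmul2l.
Qed.

Lemma integral_comb_le d (T : measurableType d) (mu : {measure set T -> \bar R})
    (D : set T) (f f1 f2 : T -> R) (K1 K2 B1 B2 : R) :
  measurable D ->
  measurable_fun D f -> measurable_fun D f1 -> measurable_fun D f2 ->
  (forall x, 0 <= f x) -> (forall x, 0 <= f1 x) -> (forall x, 0 <= f2 x) ->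
  0 <= K1 -> 0 <= K2 ->
  (forall x, D x -> f x <= K1 * f1 x + K2 * f2 x) ->
  (\int[mu]_(x in D) (f1 x)%:E <= B1%:E)%E ->
  (\int[mu]_(x in D) (f2 x)%:E <= B2%:E)%E ->
  (\int[mu]_(x in D) (f x)%:E <= (K1 * B1 + K2 * B2)%:E)%E.
Proof.
move=> mD mf m1 m2 f0 f10 f20 K10 K20 fle i1 i2.
have mK1 : measurable_fun D (fun x => K1 * f1 x) by exact: measurable_funM.
have mK2 : measurable_fun D (fun x => K2 * f2 x) by exact: measurable_funM.
apply: (@le_trans _ _ (\int[mu]_(x in D) ((K1 * f1 x)%:E + (K2 * f2 x)%:E))%E).
  apply: ge0_le_integral => //.
  - by move=> x _; rewrite lee_fin.
  - exact/measurable_EFinP.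
  - by apply: emeasurable_funD; exact/measurable_EFinP.
have n1 x : (0 <= (K1 * f1 x)%:E)%E by rewrite lee_fin mulr_ge0.
have n2 x : (0 <= (K2 * f2 x)%:E)%E by rewrite lee_fin mulr_ge0.
rewrite ge0_integralD//; [|exact/measurable_EFinP|exact/measurable_EFinP].
by rewrite EFinD leeD// integralZl_le.
Qed.

Definition disk : set plane := [set z | z.1 ^+ 2 + z.2 ^+ 2 < 1 :> R].

Lemma measurable_plane_fst : measurable_fun setT (fun z : plane => z.1 : R).
Proof. exact: measurable_fst. Qed.

Lemma measurable_plane_snd : measurable_fun setT (fun z : plane => z.2 : R).
Proof. exact: measurable_snd. Qed.

Lemma measurable_disk : measurable disk.
Proof.
apply: measurable_lt_set; apply: measurable_funD; apply: measurable_funX.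
  exact: measurable_plane_fst.
exact: measurable_plane_snd.
Qed.

(** A point of the disk with y^2 > 1/2 has x^2 <= 1/2, so two strips cover the disk. In each strip
    Tonelli is applied with the chords as inner domain, in the direction in which they meet the
    circle at an angle bounded below. The lines y = [y0] and x = [x0] are null sets left for
    singular slices. *)
Lemma integral_disk_le (g : R -> R -> R) (Phi1 Phi2 : R -> R) (K1 K2 x0 y0 : R) :
  measurable_fun setT (fun z : plane => g z.1 z.2) ->
  (forall x y, 0 <= g x y) ->
  measurable_fun setT Phi1 -> measurable_fun setT Phi2 ->
  (forall y, 0 <= Phi1 y) -> (forall x, 0 <= Phi2 x) ->
  (forall y, y <> y0 -> (y ^+ 2 <= 2^-1)%R ->
    \int[leb]_(x in [set x | (x ^+ 2 + y ^+ 2 < 1)%R]) (g x y)%:E <= (Phi1 y)%:E)%E ->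
  (forall x, x <> x0 -> (x ^+ 2 <= 2^-1)%R ->
    \int[leb]_(y in [set y | (y ^+ 2 + x ^+ 2 < 1)%R]) (g x y)%:E <= (Phi2 x)%:E)%E ->
  (\int[leb]_y (Phi1 y)%:E <= K1%:E)%E -> (\int[leb]_x (Phi2 x)%:E <= K2%:E)%E ->
  (\int[leb \x leb]_(z in disk) (g z.1 z.2)%:E <= (K1 + K2)%:E)%E.
Proof.
move=> mg g0 mP1 mP2 P10 P20 b1 b2 i1 i2.
pose D1 : set plane := disk `&` [set z | z.2 ^+ 2 <= 2^-1 :> R].
pose D2 : set plane := disk `&` [set z | z.1 ^+ 2 <= 2^-1 :> R].
have mdisk := measurable_disk.
have mD1 : measurable D1.
  apply: measurableI => //; apply: measurable_le_set; apply: measurable_funX.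
  exact: measurable_plane_snd.
have mD2 : measurable D2.
  apply: measurableI => //; apply: measurable_le_set; apply: measurable_funX.
  exact: measurable_plane_fst.
pose G (z : plane) : \bar R := (g z.1 z.2)%:E.
have mG (D : set plane) : measurable_fun D G.
  by apply/measurable_EFinP; exact: measurable_funTS.
have G0 z : (0 <= G z)%E by rewrite lee_fin.
have dU : disk = D1 `|` (disk `\` D1).
  by rewrite setDUK//; exact: subIsetl.
rewrite [X in integral _ X _]dU.
rewrite ge0_integral_setU//; last 3 first.
- exact: measurableD.

- by move=> z _; exact: G0.
- by rewrite disj_set2E setDIK.
rewrite EFinD; apply: leeD.
- rewrite integral_mkcond fubini_tonelli2; last 2 first.
  + by apply/(measurable_restrictT _ mD1); exact: mG.
  + by apply: erestrict_ge0 => z _; exact: G0.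
  apply: le_trans i1; apply: (@le_integral_off y0) => //.
  + apply: measurable_fun_fubini_tonelli_G.
      by apply/(measurable_restrictT _ mD1); exact: mG.
    by apply: erestrict_ge0 => z _; exact: G0.
  + exact/measurable_EFinP.
  + move=> y; apply: integral_ge0 => x _.
    by apply: erestrict_ge0 => z _; exact: G0.
  + move=> y _ yy0; rewrite /fubini_G.
    have [hy|hy] := lerP (y ^+ 2) 2^-1.
    * apply: le_trans (b1 y yy0 hy).
      rewrite [leRHS]integral_mkcond le_eqVlt; apply/orP; left; apply/eqP.
      apply: eq_integral => x _; rewrite !patchE /=.
      congr (if _ then _ else _); apply/idP/idP; rewrite !inE /D1 /disk /=.
        by case.
      by [].
    * rewrite integral0_eq ?lee_fin// => x _; rewrite patchE ifF//.
      by apply/negP; rewrite inE /D1 /= => -[_]; rewrite leNgt hy.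
- apply: (@le_trans _ _ (\int[leb \x leb]_(z in D2) G z)%E).
    apply: ge0_subset_integral => //; [exact: measurableD|by move=> z _; exact: G0|].
    move=> z [h1 h2]; split => //=; rewrite leNgt; apply/negP => h3.
    apply: h2; split => //=; rewrite leNgt; apply/negP => h4.
    by move: h1; rewrite /disk/=; apply/negP; rewrite -leNgt (splitr 1) div1r lerD// ltW.
  rewrite integral_mkcond fubini_tonelli1; last 2 first.
  + by apply/(measurable_restrictT _ mD2); exact: mG.
  + by apply: erestrict_ge0 => z _; exact: G0.
  apply: le_trans i2; apply: (@le_integral_off x0) => //.
  + apply: measurable_fun_fubini_tonelli_F.
      by apply/(measurable_restrictT _ mD2); exact: mG.
    by apply: erestrict_ge0 => z _; exact: G0.
  + exact/measurable_EFinP.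
  + move=> x; apply: integral_ge0 => y _.
    by apply: erestrict_ge0 => z _; exact: G0.
  + move=> x _ xx0; rewrite /fubini_F.
    have [hx|hx] := lerP (x ^+ 2) 2^-1.
    * apply: le_trans (b2 x xx0 hx).
      rewrite [leRHS]integral_mkcond le_eqVlt; apply/orP; left; apply/eqP.
      apply: eq_integral => y _; rewrite !patchE /=.
      congr (if _ then _ else _); apply/idP/idP; rewrite !inE /D2 /disk /= addrC.
        by case.
      by [].
    * rewrite integral0_eq ?lee_fin// => y _; rewrite patchE ifF//.
      by apply/negP; rewrite inE /D2 /= => -[_]; rewrite leNgt hx.
Qed.

End Plane.

(** * Lower bounds for the kernel denominator and the unweighted estimate *)

Section DiskEstimates.
Local Open Scope classical_set_scope.
Local Open Scope ring_scope.
Context {R : realType}.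
Implicit Types (a b c e q u x y A M r : R).
Local Notation leb := (@lebesgue_measure R).
Local Notation RT := (measurableTypeR R).
Local Notation plane := (RT * RT)%type.

Definition kernel1 e A (t : R) : R := `|t| `^ (- e) * (A + `|t|) `^ (- 2).

Lemma kernel1_ge0 e A t : 0 <= kernel1 e A t.
Proof. by rewrite /kernel1 mulr_ge0// powR_ge0. Qed.

Lemma measurable_kernel1 e A c : measurable_fun setT (fun x => kernel1 e A (x - c)).
Proof.
have mn : measurable_fun setT (fun x => `|x - c|).
  by apply: measurableT_comp => //; exact: measurable_funB.
apply: measurable_funM; apply: measurable_powR_comp => //.
exact: measurable_funD.
Qed.

(** [c] is meant as the coordinate of the singular point of the weight, [c1] and [c2] as the ends of
    a chord. Which end is nearer depends on x; summing over all centres avoids cutting the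
    domain. *)
Lemma integral_three_kernels (S : set RT) (g : R -> R) c c1 c2 e A M :
  0 <= e -> e < 1 -> 0 < A -> 0 <= M ->
  measurable S -> measurable_fun setT g -> (forall x, 0 <= g x) ->
  (forall x, S x -> x <> c ->
    g x <= M * (kernel1 e A (x - c) + kernel1 e A (x - c1) + kernel1 e A (x - c2))) ->
  (\int[leb]_(x in S) (g x)%:E <= (M * 3 * (2 / (1 - e) * A `^ (- 1 - e)))%:E)%E.
Proof.
move=> e0 e1 A0 M0 mS mg g0 gk.
pose k c (x : RT) := (kernel1 e A ((x : R) - c))%:E.
have mk c' : measurable_fun setT (k c') by apply/measurable_EFinP; exact: measurable_kernel1.
have k0 c' x : (0 <= k c' x)%E by rewrite lee_fin kernel1_ge0.
have k30 x : (0 <= k c x + k c1 x + k c2 x)%E by do 2?apply: adde_ge0.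
have ik c' := integral_powR_kernel_le c' e0 e1 A0.
apply: (@le_trans _ _ (\int[leb]_x (M%:E * (k c x + k c1 x + k c2 x)))%E).
  apply: (@le_integral_off _ c) => //.
  - exact/measurable_EFinP.
  - apply: emeasurable_funM => //; apply: emeasurable_funD => //; exact: emeasurable_funD.
  - by move=> x; apply: mule_ge0; [rewrite lee_fin|exact: k30].
have mk12 := emeasurable_funD (mk c) (mk c1).
have mk3 := emeasurable_funD mk12 (mk c2).
have k20 x : (0 <= k c x + k c1 x)%E by exact: adde_ge0.
rewrite ge0_integralZl_EFin// ge0_integralD//.
rewrite -mulrA EFinM; apply: lee_wpmul2l; first by rewrite lee_fin.
set K := _ * _ `^ _; have -> : 3 * K = K + K + K by ring.
rewrite !EFinD; apply: leeD; last exact: ik.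
rewrite ge0_integralD//; apply: leeD; exact: ik.
Qed.

(* For z = x + iy and w = a + ib: defect is 1 - |z|^2, kden is |1 - w z^*|^2
   and edist is |z - w|. *)
Definition defect x y : R := 1 - (x ^+ 2 + y ^+ 2).

Definition kden a b x y : R := (1 - (a * x + b * y)) ^+ 2 + (b * x - a * y) ^+ 2.

Definition edist a b x y : R := Num.sqrt ((x - a) ^+ 2 + (y - b) ^+ 2).

Lemma defectC x y : defect x y = defect y x.
Proof. by rewrite /defect addrC [in RHS]addrC (addrC (x ^+ 2)). Qed.

Lemma kdenC a b x y : kden a b x y = kden b a y x.
Proof. rewrite /kden; ring. Qed.

Lemma kden_sym a b x y : kden a b x y = kden x y a b.
Proof. rewrite /kden; ring. Qed.

Lemma edistC a b x y : edist a b x y = edist b a y x.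
Proof. by rewrite /edist addrC. Qed.

Lemma kdenE a b x y :
  kden a b x y = (x - a) ^+ 2 + (y - b) ^+ 2 + defect a b * defect x y.
Proof. rewrite /kden /defect; ring. Qed.

(** The real part of 1 - w conj(z) exceeds the mean of the two defects by |z-w|^2 / 2. *)
Lemma kden_ge_defect a b x y : 0 < defect a b -> 0 < defect x y ->
  ((defect a b + defect x y) / 2) ^+ 2 <= kden a b x y.
Proof.
move=> da dx.
have h : (defect a b + defect x y) / 2 <= 1 - (a * x + b * y).
  have : 0 <= (x - a) ^+ 2 + (y - b) ^+ 2 by rewrite addr_ge0 ?sqr_ge0.
  rewrite /defect -subr_ge0 => h; rewrite -subr_ge0.
  rewrite [leRHS](_ : _ = ((x - a) ^+ 2 + (y - b) ^+ 2 - 0) / 2); last by field.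
  by rewrite divr_ge0.
have h0 : 0 <= (defect a b + defect x y) / 2 by rewrite divr_ge0// addr_ge0 ?ltW.
rewrite /kden; apply: (@le_trans _ _ ((1 - (a * x + b * y)) ^+ 2)).
  by rewrite ler_sqr ?nnegrE// (le_trans h0).
by rewrite lerDl sqr_ge0.
Qed.

Lemma kden_gt0 a b x y : 0 < defect a b -> 0 < defect x y -> 0 < kden a b x y.
Proof.
move=> da dx; apply: lt_le_trans (kden_ge_defect da dx).
by rewrite exprn_gt0// divr_gt0// addr_gt0.
Qed.

(** Free of square roots, this says that t + s <= 5 sqrt(N), because P and s are at most sqrt(N);
    hence 25. *)
Lemma sqr_triangle_le (N P s t : R) : 0 <= s -> 0 <= t -> t <= 4 * P ->
  P ^+ 2 <= N -> s ^+ 2 <= N -> (t + s) ^+ 2 <= 25 * N.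
Proof.
move=> s0 t0 tP PN sN.
have : (t + s) ^+ 2 <= (4 * P + s) ^+ 2 by rewrite ler_sqr ?nnegrE ?addr_ge0//; lra.
have : 0 <= (P - s) ^+ 2 by exact: sqr_ge0.
nra.
Qed.

Lemma kden_ge_boundary a b x y T : 0 < defect a b -> 0 < defect x y ->
  0 <= T -> T <= 2 * defect x y ->
  (defect a b + `|y - b| + T) ^+ 2 <= 25 * kden a b x y.
Proof.
move=> da dx T0 Td; rewrite addrAC.
apply: (@sqr_triangle_le _ ((defect a b + defect x y) / 2)) => //.
- by rewrite addr_ge0// ltW.
- lra.
- exact: kden_ge_defect.
- rewrite real_normK ?num_real// kdenE.
  have := sqr_ge0 (x - a); have := mulr_gt0 da dx; lra.
Qed.

(** With X = sqrt(1-y^2) the defect factors as (X-x)(X+x). One factor is the distance T to the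
    nearer end of the chord; the other is at least X >= 1/2, which gives the constant 2. *)
Lemma dist_circle x y : y ^+ 2 <= 2^-1 -> 0 < defect x y ->
  exists T, [/\ 0 < T, T <= 2 * defect x y &
    T = `|x - Num.sqrt (1 - y ^+ 2)| \/ T = `|x - - Num.sqrt (1 - y ^+ 2)| ].
Proof.
move=> hy d0; set X := Num.sqrt _.
have y1 : 0 <= 1 - y ^+ 2 by lra.
have XE : X ^+ 2 = 1 - y ^+ 2 by rewrite sqr_sqrtr.
have X0 : 0 <= X by exact: sqrtr_ge0.
have X2 : 2^-1 <= X by nra.
have dE : defect x y = (X - x) * (X + x).
  by rewrite -subr_sqr XE /defect; ring.
have [x0|x0] := lerP 0 x.
- have h : 0 < X - x.
    rewrite ltNge; apply/negP => h; move: d0; rewrite dE; apply/negP; rewrite -leNgt.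
    by rewrite mulr_le0_ge0// addr_ge0.
  exists (X - x); split => //; last by left; rewrite distrC gtr0_norm.
  rewrite dE; nra.
- have h : 0 < X + x.
    rewrite ltNge; apply/negP => h; move: d0; rewrite dE; apply/negP; rewrite -leNgt.
    by rewrite mulr_ge0_le0//; lra.
  exists (X + x); split => //; last by right; rewrite opprK addrC gtr0_norm// addrC.
  rewrite dE; nra.
Qed.

Lemma powR_half_le u T d : 0 <= u -> u < 1 -> 0 < T -> T <= 2 * d ->
  d `^ (- u) <= 2 * T `^ (- u).
Proof.
move=> u0 u1 T0 Td; have d0 : 0 < d by lra.
have h : (2 * d) `^ (- u) <= T `^ (- u) by apply: le0_ler_powR; rewrite ?oppr_le0.
have -> : d `^ (- u) = 2 `^ u * (2 * d) `^ (- u).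
  by rewrite powRM// ?(ltW d0)// mulrA powRNK// mul1r.
apply: ler_pM => //; rewrite ?powR_ge0//.
by rewrite -[leRHS]powRr1//; apply: ler_powR; lra.
Qed.

Lemma measurable_edist a b : measurable_fun setT (fun z : plane => edist a b z.1 z.2).
Proof.
apply: (measurableT_comp (continuous_measurable_fun (@sqrt_continuous R))).
by apply: measurable_funD; apply: measurable_funX; apply: measurable_funB.
Qed.

Lemma measurable_defect : measurable_fun setT (fun z : plane => defect z.1 z.2).
Proof.
apply: measurable_funB => //; apply: measurable_funD; apply: measurable_funX.
  exact: measurable_plane_fst.
exact: measurable_plane_snd.
Qed.

Lemma measurable_kden a b : measurable_fun setT (fun z : plane => kden a b z.1 z.2).
Proof.
have m1 := measurable_plane_fst; have m2 := measurable_plane_snd.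
by apply: measurable_funD; apply: measurable_funX; apply: measurable_funB => //;
  try apply: measurable_funD; apply: measurable_funM => //.
Qed.

Lemma measurable_section2 (f : plane -> R) (y : R) :
  measurable_fun setT f -> measurable_fun setT (fun x : RT => f (x, y)).
Proof. by move=> mf; apply: (measurableT_comp mf); exact: measurable_pair2. Qed.

Definition bergman_weight u a b x y : R := defect x y `^ (- u) * kden a b x y `^ (- 1).

Lemma measurable_bergman_weight u a b :
  measurable_fun setT (fun z : plane => bergman_weight u a b z.1 z.2).
Proof.
by apply: measurable_funM; apply: measurable_powR_comp;
  [exact: measurable_defect|exact: measurable_kden].
Qed.

Lemma bergman_weightC u a b x y : bergman_weight u a b x y = bergman_weight u b a y x.
Proof. by rewrite /bergman_weight defectC kdenC. Qed.

(** On the chord, 1/[kden] is at most 25 (A+T)^(-2) with A = [defect a b] + |y-b|, and the remaining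
    T^(-u) is integrable because u < 1. The factor 50 is 25 times the 2 of [powR_half_le], and 3
    counts the kernels. The result A^(-1-u) is still integrable in y. *)
Lemma integral_bergman_weight_line u a b y :
  0 < u -> u < 1 -> 0 < defect a b -> y ^+ 2 <= 2^-1 ->
  (\int[leb]_(x in [set x | (x ^+ 2 + y ^+ 2 < 1)%R]) (bergman_weight u a b x y)%:E
    <= (50 * 3 * (2 / (1 - u) * (defect a b + `|y - b|) `^ (- 1 - u)))%:E)%E.
Proof.
move=> u0 u1 da hy.
have A0 : 0 < defect a b + `|y - b| by rewrite ltr_wpDr.
pose X := Num.sqrt (1 - y ^+ 2).
(* There is no interior singularity here, so an end of the chord is repeated as first centre. *)
apply: (@integral_three_kernels _ _ X X (- X)) => //.
- exact: ltW.
- apply: measurable_lt_set; apply: measurable_funD => //; exact: measurable_funX.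
- exact: (measurable_section2 y (measurable_bergman_weight u a b)).
- by move=> x; rewrite mulr_ge0 ?powR_ge0.
move=> x /= hx _.
have d0 : 0 < defect x y by rewrite /defect subr_gt0.
have [T [T0 Td TX]] := dist_circle hy d0.
have hN := kden_ge_boundary da d0 (ltW T0) Td.
have N0 := kden_gt0 da d0.
have dT := powR_half_le (ltW u0) u1 T0 Td.
set A := defect a b + `|y - b| in A0 hN *.
have AT0 : 0 < A + T by rewrite addr_gt0.
have NT : kden a b x y `^ (- 1) <= 25 * (A + T) `^ (- 2).
  rewrite powR_inv1 ?(ltW N0)// powR_invn ?(ltW AT0)//.
  rewrite -[leRHS]invrK lef_pV2 ?posrE//; last by rewrite invr_gt0 mulr_gt0// invr_gt0 exprn_gt0.
  by rewrite invfM invrK mulrC ler_pdivrMr// mulrC.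
have hT : bergman_weight u a b x y <= 50 * (T `^ (- u) * (A + T) `^ (- 2)).
  have -> : 50 * (T `^ (- u) * (A + T) `^ (- 2)) = (2 * T `^ (- u)) * (25 * (A + T) `^ (- 2)).
    by ring.
  by apply: ler_pM; rewrite ?powR_ge0.
apply: le_trans hT _; apply: ler_wpM2l => //.
have kT (v : R) : T = `|v| -> T `^ (- u) * (A + T) `^ (- 2) = kernel1 u A v.
  by move=> ->.
case: TX => /kT ->; rewrite -/X.
- by rewrite -addrA lerDl addr_ge0// kernel1_ge0.
- by rewrite lerDr addr_ge0// kernel1_ge0.
Qed.

Lemma integral_bergman_weight_le u : 0 < u -> u < 1 ->
  exists2 C : R, 0 <= C & forall a b, 0 < defect a b ->
  (\int[leb \x leb]_(z in disk) (bergman_weight u a b z.1 z.2)%:E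
    <= (C * defect a b `^ (- u))%:E)%E.
Proof.
move=> u0 u1.
pose K := 50 * 3 * (2 / (1 - u)).
have K0 : 0 <= K by rewrite mulr_ge0// divr_ge0// subr_ge0 ltW.
exists (K * (2 / u) + K * (2 / u)).
  by rewrite addr_ge0// mulr_ge0// divr_ge0// ltW.
move=> a b da.
have mPhi c : measurable_fun setT (fun y => K * (defect a b + `|y - c|) `^ (- 1 - u)).
  apply: measurable_funM => //; apply: measurable_powR_comp; apply: measurable_funD => //.
  by apply: measurableT_comp => //; exact: measurable_funB.
have Phi0 c y : 0 <= K * (defect a b + `|y - c|) `^ (- 1 - u) by rewrite mulr_ge0// powR_ge0.
have iPhi c : (\int[leb]_y (K * (defect a b + `|y - c|) `^ (- 1 - u))%:E
    <= (K * (2 / u) * defect a b `^ (- u))%:E)%E.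
  rewrite -(mulrA K); apply: integralZl_le => //;
    [|by move=> x; exact: powR_ge0|exact: integral_powR_tail_le].
  apply: measurable_powR_comp; apply: measurable_funD => //.
  by apply: measurableT_comp => //; exact: measurable_funB.
rewrite mulrDl.
(* The slice bounds hold on every line, so the exceptional coordinates are arbitrary. *)
apply: (@integral_disk_le _ (bergman_weight u a b) _ _ _ _ 2 2
   (measurable_bergman_weight u a b) _ (mPhi b) (mPhi a)) => //.
- by move=> x y; rewrite mulr_ge0 ?powR_ge0.
- move=> y _ hy; apply: le_trans (integral_bergman_weight_line u0 u1 da hy) _.
  by rewrite lee_fin mulrA.
- move=> x _ hx; rewrite defectC in da *.
  under eq_integral do rewrite bergman_weightC.
  apply: le_trans (integral_bergman_weight_line u0 u1 da hx) _.
  by rewrite lee_fin mulrA.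
Qed.
End DiskEstimates.

(** * The estimate with a singularity at a point of the plane *)

Section WeightedEstimates.
Local Open Scope classical_set_scope.
Local Open Scope ring_scope.
Context {R : realType}.
Implicit Types (a b c e q u x y A M r s t T : R).
Local Notation leb := (@lebesgue_measure R).
Local Notation RT := (measurableTypeR R).
Local Notation plane := (RT * RT)%type.

(** This decouples the singularities at s = 0 and T = 0: all powers decrease, so replacing the
    larger of s and T by the smaller one only increases the product. *)
Lemma mixed_kernel_le q u r s T : 0 <= q -> 0 <= u -> 0 < r -> 0 < s -> 0 < T ->
  s `^ (- q) * T `^ (- u) * (r + s) `^ (- 2) <=
  s `^ (- (q + u)) * (r + s) `^ (- 2) + T `^ (- (q + u)) * (r + T) `^ (- 2).
Proof.
move=> q0 u0 r0 s0 T0.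
have p0 (v w z : R) : 0 <= v `^ w * z `^ (- 2) by rewrite mulr_ge0 ?powR_ge0.
rewrite !(opprD q) !(powRD_gt0 (- q) (- u))//.
have [sT|Ts] := leP s T.
- apply: (@le_trans _ _ (s `^ (- q) * s `^ (- u) * (r + s) `^ (- 2))).
    rewrite ler_wpM2r ?powR_ge0// ler_wpM2l ?powR_ge0//.
    by apply: le0_ler_powR; rewrite ?oppr_le0.
  by rewrite lerDl !mulr_ge0 ?powR_ge0.
- apply: (@le_trans _ _ (T `^ (- q) * T `^ (- u) * (r + T) `^ (- 2))).
    apply: ler_pM; rewrite ?mulr_ge0 ?powR_ge0//.
      rewrite ler_wpM2r ?powR_ge0//.
      by apply: le0_ler_powR; rewrite ?oppr_le0// ltW.
    by apply: le0_ler_powR; rewrite ?oppr_le0// ?addr_gt0// lerD2l ltW.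
  by rewrite lerDr !mulr_ge0 ?powR_ge0.
Qed.

(* (r + |z - a|)^(-4) stands for the indicator function of |z - a| < r: unlike
   the latter it is dominated by a product of functions of the coordinates. *)
Definition local_weight q u r a b x y : R :=
  edist a b x y `^ (- q) * defect x y `^ (- u) * (r + edist a b x y) `^ (- 4).

Lemma local_weight_ge0 q u r a b x y : 0 <= local_weight q u r a b x y.
Proof. by rewrite !mulr_ge0 ?powR_ge0. Qed.

Lemma local_weightC q u r a b x y :
  local_weight q u r a b x y = local_weight q u r b a y x.
Proof. by rewrite /local_weight edistC defectC. Qed.

Lemma measurable_local_weight q u r a b :
  measurable_fun setT (fun z : plane => local_weight q u r a b z.1 z.2).
Proof.
have me := measurable_edist a b.
apply: measurable_funM; last first.
  by apply: measurable_powR_comp; exact: measurable_funD.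
apply: measurable_funM; apply: measurable_powR_comp => //.
exact: measurable_defect.
Qed.

Lemma edist_ge1 a b x y : `|x - a| <= edist a b x y.
Proof. by rewrite -sqrtr_sqr ler_wsqrtr// lerDl sqr_ge0. Qed.

Lemma edist_ge2 a b x y : `|y - b| <= edist a b x y.
Proof. by rewrite edistC edist_ge1. Qed.

Lemma sqr_edist a b x y : edist a b x y ^+ 2 = (x - a) ^+ 2 + (y - b) ^+ 2.
Proof. by rewrite sqr_sqrtr// addr_ge0 ?sqr_ge0. Qed.

(** [edist] is at least |x-a| and at least |y-b|, so its powers split between the coordinates: q =
    q1 + q2, and the exponent 4 as 2 + 2, just enough for one kernel in each variable. The x-part is
    then separated by [mixed_kernel_le]. *)
Lemma integral_local_weight_line q1 q2 u r a b y :
  0 <= q1 -> 0 <= q2 -> 0 <= u -> u < 1 -> q1 + u < 1 -> 0 < r ->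
  y <> b -> y ^+ 2 <= 2^-1 ->
  (\int[leb]_(x in [set x | (x ^+ 2 + y ^+ 2 < 1)%R])
      (local_weight (q1 + q2) u r a b x y)%:E
    <= (2 * 3 * (2 / (1 - (q1 + u)) * r `^ (- 1 - (q1 + u))) * kernel1 q2 r (y - b))%:E)%E.
Proof.
move=> q10 q20 u0 u1 e1 r0 yb hy.
pose X := Num.sqrt (1 - y ^+ 2).
set K := kernel1 _ _ _.
have -> : 2 * 3 * (2 / (1 - (q1 + u)) * r `^ (- 1 - (q1 + u))) * K =
  2 * K * 3 * (2 / (1 - (q1 + u)) * r `^ (- 1 - (q1 + u))) by ring.
have K0 : 0 <= K by exact: kernel1_ge0.
apply: (@integral_three_kernels _ _ _ a X (- X)) => //.
- exact: addr_ge0.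
- exact: mulr_ge0.
- apply: measurable_lt_set; apply: measurable_funD => //; exact: measurable_funX.
- exact: (measurable_section2 y (measurable_local_weight (q1 + q2) u r a b)).
- by move=> x; exact: local_weight_ge0.
move=> x /= hx /eqP; rewrite -subr_eq0 => xa.
have d0 : 0 < defect x y by rewrite /defect subr_gt0.
have [T [T0 Td TX]] := dist_circle hy d0.
have dT := powR_half_le u0 u1 T0 Td.
have s0 : 0 < `|x - a| by rewrite normr_gt0.
have t0 : 0 < `|y - b| by rewrite normr_gt0 subr_eq0; exact/eqP.
have sr := edist_ge1 a b x y; have tr := edist_ge2 a b x y.
pose rho := edist a b x y; rewrite -/rho in sr tr.
have rho0 : 0 < rho by exact: lt_le_trans sr.
pose s := `|x - a|; pose t := `|y - b|; rewrite -/s in s0 sr; rewrite -/t in t0 tr.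
have h1 : rho `^ (- (q1 + q2)) <= s `^ (- q1) * t `^ (- q2).
  rewrite opprD (powRD_gt0 (- q1) (- q2))//; apply: ler_pM; rewrite ?powR_ge0//.
    by apply: le0_ler_powR; rewrite ?oppr_le0.
  by apply: le0_ler_powR; rewrite ?oppr_le0.
have h2 : (r + rho) `^ (- 4) <= (r + s) `^ (- 2) * (r + t) `^ (- 2).
  rewrite (_ : - 4 = - 2 + - 2 :> R); last by ring.
  rewrite (powRD_gt0 (- 2) (- 2)) ?addr_gt0//; apply: ler_pM; rewrite ?powR_ge0//.
    by apply: le0_ler_powR; rewrite ?oppr_le0 ?addr_gt0 ?lerD2l.
  by apply: le0_ler_powR; rewrite ?oppr_le0 ?addr_gt0 ?lerD2l.
have h3 := mixed_kernel_le q10 u0 r0 s0 T0.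
have hl : local_weight (q1 + q2) u r a b x y <=
    (s `^ (- q1) * t `^ (- q2)) * (2 * T `^ (- u)) * ((r + s) `^ (- 2) * (r + t) `^ (- 2)).
  by rewrite /local_weight !ler_pM ?mulr_ge0 ?powR_ge0.
apply: le_trans hl _.
rewrite [leLHS](_ : _ = 2 * K * (s `^ (- q1) * T `^ (- u) * (r + s) `^ (- 2))); last first.
  by rewrite /K /kernel1 -/t; ring.
apply: ler_wpM2l; first exact: mulr_ge0.
apply: le_trans h3 _.
have kT (v : R) : T = `|v| -> T `^ (- (q1 + u)) * (r + T) `^ (- 2) = kernel1 (q1 + u) r v.
  by move=> ->.
rewrite -/(kernel1 (q1 + u) r (x - a)) -addrA lerD2l.
case: TX => /kT ->; rewrite -/X.
- by rewrite lerDl kernel1_ge0.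
- by rewrite lerDr kernel1_ge0.
Qed.

Lemma integral_local_weight_le q u : 0 <= q -> 0 <= u -> u < 1 -> q + u < 2 ->
  exists2 C : R, 0 <= C & forall a b r, 0 < r ->
  (\int[leb \x leb]_(z in disk) (local_weight q u r a b z.1 z.2)%:E
    <= (C * r `^ (- 2 - q - u))%:E)%E.
Proof.
move=> q0 u0 u1 qu.
(* |z - a|^(-q) <= |x - a1|^(-q1) |y - a2|^(-q2); the exponents q1 + u and q2
     must both be integrable on the line. *)
pose q1 := q * (1 - u) / (2 - u); pose q2 := q / (2 - u).
have u2 : 0 < 2 - u by lra.
have qE : q = q1 + q2 by rewrite /q1 /q2; field; rewrite gt_eqF.
have q10 : 0 <= q1 by rewrite divr_ge0// ?mulr_ge0//; lra.
have q20 : 0 <= q2 by rewrite divr_ge0//; lra.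
have q21 : q2 < 1 by rewrite ltr_pdivrMr//; lra.
(* 1 - (q1 + u) = (1 - u)(1 - q2), so both integrability conditions amount to q + u < 2. *)
have e1 : q1 + u < 1.
  have : q1 = q2 * (1 - u) by rewrite /q1 /q2; ring.
  nra.
pose K := 2 * 3 * (2 / (1 - (q1 + u))) * (2 / (1 - q2)).
have K0 : 0 <= K by rewrite !mulr_ge0// ?invr_ge0; lra.
exists (K + K); first exact: addr_ge0.
move=> a b r r0.
pose L := 2 * 3 * (2 / (1 - (q1 + u)) * r `^ (- 1 - (q1 + u))).
have L0 : 0 <= L by rewrite !mulr_ge0 ?powR_ge0// ?invr_ge0; lra.
have LK : L * (2 / (1 - q2) * r `^ (- 1 - q2)) = K * r `^ (- 2 - q - u).
  rewrite (_ : - 2 - q - u = (- 1 - (q1 + u)) + (- 1 - q2)); last by rewrite qE; ring.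
  rewrite (powRD_gt0 (- 1 - (q1 + u)) (- 1 - q2) r0) /L /K; ring.
have mPhi c : measurable_fun setT (fun y => L * kernel1 q2 r (y - c)).
  by apply: measurable_funM => //; exact: measurable_kernel1.
have Phi0 c y : 0 <= L * kernel1 q2 r (y - c) by rewrite mulr_ge0// kernel1_ge0.
have iPhi c : (\int[leb]_y (L * kernel1 q2 r (y - c))%:E <= (K * r `^ (- 2 - q - u))%:E)%E.
  rewrite -LK; apply: integralZl_le => //;
    [exact: measurable_kernel1|by move=> x; exact: kernel1_ge0|].
  exact: integral_powR_kernel_le.
rewrite mulrDl.
apply: (@integral_disk_le _ (local_weight q u r a b) _ _ _ _ a b
   (measurable_local_weight q u r a b) _ (mPhi b) (mPhi a)) => //.
- by move=> x y; exact: local_weight_ge0.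
- move=> y yb hy; rewrite qE.
  exact: integral_local_weight_line.
- move=> x xa hx.
  rewrite qE; under eq_integral do rewrite local_weightC.
  exact: integral_local_weight_line.
Qed.

(** The points z and w are within a multiple of r of each other, so their defects differ by at most
    4r, that is by at most half of the defect of w. *)
Lemma defect_ge_half a b w1 w2 x y (r : R) :
  0 < r -> r ^+ 2 = (w1 - a) ^+ 2 + (w2 - b) ^+ 2 ->
  (x - a) ^+ 2 + (y - b) ^+ 2 <= r ^+ 2 / 4 ->
  0 < defect w1 w2 -> 0 < defect x y -> 8 * r <= defect w1 w2 ->
  defect w1 w2 <= 2 * defect x y.
Proof.
move=> r0 rE zr dw dz r8.
have hzw : (x - w1) ^+ 2 + (y - w2) ^+ 2 <= (5 / 2) * r ^+ 2.
  have h1 := sqr_ge0 ((x - a) + (w1 - a)); have h2 := sqr_ge0 ((y - b) + (w2 - b)).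
  rewrite (_ : (x - w1) ^+ 2 + (y - w2) ^+ 2 =
    2 * ((x - a) ^+ 2 + (y - b) ^+ 2) + 2 * ((w1 - a) ^+ 2 + (w2 - b) ^+ 2)
    - (((x - a) + (w1 - a)) ^+ 2 + ((y - b) + (w2 - b)) ^+ 2)); last by ring.
  by rewrite -rE; lra.
have hs : (x + w1) ^+ 2 + (y + w2) ^+ 2 <= 4.
  have h1 := sqr_ge0 (x - w1); have h2 := sqr_ge0 (y - w2).
  rewrite (_ : (x + w1) ^+ 2 + (y + w2) ^+ 2 =
    4 - 2 * defect w1 w2 - 2 * defect x y - ((x - w1) ^+ 2 + (y - w2) ^+ 2)); last first.
    by rewrite /defect; ring.
  lra.
(* The difference of the defects is the inner product of z - w and z + w. The bound 2 r A.B <= |A|^2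
   + r^2 |B|^2 replaces Cauchy-Schwarz and gives (5/2 + 4) r^2 / 2 <= 4 r^2. *)
have h : r * (defect w1 w2 - defect x y) <= r * (4 * r).
  have h1 := sqr_ge0 ((x - w1) - r * (x + w1)).
  have h2 := sqr_ge0 ((y - w2) - r * (y + w2)).
  have h3 : r ^+ 2 * ((x + w1) ^+ 2 + (y + w2) ^+ 2) <= r ^+ 2 * 4.
    by rewrite ler_wpM2l// sqr_ge0.
  rewrite (_ : r * (defect w1 w2 - defect x y) =
   (((x - w1) ^+ 2 + (y - w2) ^+ 2) + r ^+ 2 * ((x + w1) ^+ 2 + (y + w2) ^+ 2)
    - (((x - w1) - r * (x + w1)) ^+ 2 + ((y - w2) - r * (y + w2)) ^+ 2)) / 2); last first.
    by rewrite /defect; field.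
  rewrite (_ : r * (4 * r) = 4 * r ^+ 2); last by ring.
  have := sqr_ge0 r; lra.
rewrite ler_pM2l// in h; lra.
Qed.

Lemma kden_inv_near a b w1 w2 x y (r : R) :
  0 < r -> r ^+ 2 = (w1 - a) ^+ 2 + (w2 - b) ^+ 2 ->
  (x - a) ^+ 2 + (y - b) ^+ 2 <= r ^+ 2 / 4 ->
  0 < defect w1 w2 -> 0 < defect x y ->
  kden w1 w2 x y `^ (- 1) <= 4 * r `^ (- 2).
Proof.
move=> r0 rE zr dw dz.
have hN : r ^+ 2 / 4 <= kden w1 w2 x y.
  have h1 := sqr_ge0 ((x - a) + (x - w1)); have h2 := sqr_ge0 ((y - b) + (y - w2)).
  have h3 := mulr_gt0 dw dz.
  have e : r ^+ 2 = 2 * ((x - a) ^+ 2 + (y - b) ^+ 2) + 2 * ((x - w1) ^+ 2 + (y - w2) ^+ 2)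
    - (((x - a) + (x - w1)) ^+ 2 + ((y - b) + (y - w2)) ^+ 2) by rewrite rE; ring.
  rewrite kdenE; lra.
have N0 := kden_gt0 dw dz.
rewrite powR_inv1 ?(ltW N0)// powR_invn ?(ltW r0)//.
rewrite -[leRHS]invrK lef_pV2 ?posrE//; last by rewrite invr_gt0 mulr_gt0// invr_gt0 exprn_gt0.
by rewrite invfM invrK mulrC.
Qed.

(** Far from (a, b) the weight is comparable to its value at w and the unweighted estimate applies.
    Near (a, b) the kernel is at most 4 r^(-2), and the local integral is taken with exponent u or 0
    according to the size of r relative to the defect of w. *)
Lemma integral_weighted_bergman_weight_le q u :
  0 <= q -> 0 < u -> u < 1 -> q + u < 2 ->
  exists2 C : R, 0 <= C & forall a b w1 w2, 0 < defect w1 w2 -> 0 < edist a b w1 w2 ->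
  (\int[leb \x leb]_(z in disk)
      (edist a b z.1 z.2 `^ (- q) * bergman_weight u w1 w2 z.1 z.2)%:E
    <= (C * (edist a b w1 w2 `^ (- q) * defect w1 w2 `^ (- u)))%:E)%E.
Proof.
move=> q0 u0 u1 qu.
have [C1 C10 i1] := integral_bergman_weight_le u0 u1.
have [C2 C20 i2] := integral_local_weight_le q0 (ltW u0) u1 qu.
have q02 : q + 0 < 2 by lra.
have [C3 C30 i3] := integral_local_weight_le q0 (lexx 0) ltr01 q02.
have p (n : nat) (D : R) : 0 <= D -> 0 <= n%:R * D by move=> ?; rewrite mulr_ge0 ?ler0n.
(* The far region costs 4 >= 2^q. The near region costs 64 = 4 * 16, with 4 from the kernel and 16 =
   2^4 from the substitute for the indicator; then 512 = 64 * 8 if [dl] < 8r and 128 = 64 * 2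
   otherwise. *)
exists (4 * C1 + 512 * C2 + 128 * C3).
  by apply: addr_ge0; [apply: addr_ge0|]; exact: p.
move=> a b w1 w2 dw; set r := edist a b w1 w2 => r0.
have rE : r ^+ 2 = (w1 - a) ^+ 2 + (w2 - b) ^+ 2 by exact: sqr_edist.
have r2 : r ^+ 2 = r `^ 2 by rewrite powR_mulrn// ltW.
have r4 : r ^+ 4 = r `^ 4 by rewrite powR_mulrn// ltW.
set dl := defect w1 w2 in dw *.
pose W (z : plane) : R := edist a b z.1 z.2 `^ (- q) * bergman_weight u w1 w2 z.1 z.2.
have bw0 (z : plane) : 0 <= bergman_weight u w1 w2 z.1 z.2 by rewrite mulr_ge0 ?powR_ge0.
have mbw := measurable_bergman_weight u w1 w2.
have mW : measurable_fun setT W.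
  by apply: measurable_funM => //; apply: measurable_powR_comp; exact: measurable_edist.
have W0 z : 0 <= W z by rewrite mulr_ge0// powR_ge0.
have far (z : plane) : r / 2 <= edist a b z.1 z.2 ->
    W z <= (4 * r `^ (- q)) * bergman_weight u w1 w2 z.1 z.2.
  move=> h; apply: ler_wpM2r => //.
  apply: (@le_trans _ _ ((r / 2) `^ (- q))).
    by apply: le0_ler_powR => //; [rewrite oppr_le0|rewrite divr_gt0].
  rewrite powRM ?invr_ge0 ?(ltW r0)// mulrC ler_wpM2r ?powR_ge0//.
  rewrite -powR_inv1// -powRrM mulrNN mul1r.
  rewrite (_ : 4 = 2 `^ 2); last by rewrite powR_mulrn//; ring.
  by apply: ler_powR; rewrite ?ler1n//; clear -q0 qu u0; lra.
have near (z : plane) : disk z -> edist a b z.1 z.2 < r / 2 ->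
    W z <= (64 * r `^ 2) * local_weight q u r a b z.1 z.2 /\
    (8 * r <= dl ->
       W z <= (128 * r `^ 2 * dl `^ (- u)) * local_weight q 0 r a b z.1 z.2).
  move=> Dz h.
  have dz : 0 < defect z.1 z.2 by rewrite /defect subr_gt0.
  have zr : (z.1 - a) ^+ 2 + (z.2 - b) ^+ 2 <= r ^+ 2 / 4.
    rewrite -sqr_edist (_ : r ^+ 2 / 4 = (r / 2) ^+ 2); last by field.
    by rewrite ler_sqr ?nnegrE ?sqrtr_ge0 ?divr_ge0 ?(ltW h) ?(ltW r0).
  have hN := kden_inv_near r0 rE zr dw dz.
  set rho := edist a b z.1 z.2 in h *.
  have rho0 : 0 <= rho by exact: sqrtr_ge0.
  (* The smooth substitute dominates the indicator function, because r + rho <= 2r in the near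
     region. *)
  have hr : 1 <= 16 * r `^ 4 * (r + rho) `^ (- 4).
    have e : 16 * r `^ 4 = (2 * r) `^ 4.
      have e2 : 2 `^ 4 = 16 :> R by rewrite (@powR_mulrn _ 2 4)//; ring.
      by rewrite powRM ?(ltW r0)// e2.
    rewrite e; apply: (@le_trans _ _ ((2 * r) `^ 4 * (2 * r) `^ (- 4))).
      by rewrite powRNK// mulr_gt0.
    rewrite ler_wpM2l ?powR_ge0//; apply: le0_ler_powR.
    - by rewrite oppr_le0.
    - by rewrite ltr_wpDr.
    - lra.
  have rr : r `^ (- 2) * r `^ 4 = r `^ 2.
    by rewrite -powRD_gt0//; congr (_ `^ _); ring.
  set P := rho `^ (- q); set Q := defect z.1 z.2 `^ (- u).
  have P0 : 0 <= P by exact: powR_ge0.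
  have Q0 : 0 <= Q by exact: powR_ge0.
  have h64 : W z <= (64 * r `^ 2) * local_weight q u r a b z.1 z.2.
    apply: (@le_trans _ _ (P * (Q * (4 * r `^ (- 2))) * 1)).
      by rewrite mulr1 ler_wpM2l// ler_wpM2l.
    apply: (@le_trans _ _ (P * (Q * (4 * r `^ (- 2))) * (16 * r `^ 4 * (r + rho) `^ (- 4)))).
      by rewrite ler_wpM2l// !mulr_ge0// powR_ge0.
    rewrite /local_weight -/rho -/P -/Q -rr le_eqVlt; apply/orP; left; apply/eqP; ring.
  split=> // r8; apply: le_trans h64 _.
  have dd := defect_ge_half r0 rE zr dw dz r8.
  have hQ : Q <= 2 * dl `^ (- u) by exact: powR_half_le (ltW u0) u1 dw dd.
  rewrite /local_weight -/rho -/P -/Q oppr0 powRr0 mulr1.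
  set S := (r + rho) `^ _; have S0 : 0 <= S by exact: powR_ge0.
  rewrite (_ : 128 * _ * _ * _ = (64 * r `^ 2 * (P * S)) * (2 * dl `^ (- u))); last by ring.
  rewrite (_ : 64 * _ * _ = (64 * r `^ 2 * (P * S)) * Q); last by ring.
  by rewrite ler_wpM2l// !mulr_ge0// powR_ge0.
have mdisk : measurable (@disk R) by exact: measurable_disk.
have i1' := i1 _ _ dw.
have rq : r `^ 2 * r `^ (- 2 - q - 0) = r `^ (- q).
  by rewrite -powRD_gt0//; congr (_ `^ _); ring.
have X0 : 0 <= r `^ (- q) * dl `^ (- u) by rewrite mulr_ge0 ?powR_ge0.
have [r8|r8] := leP (8 * r) dl.
- have := @integral_comb_le _ _ plane (leb \x leb)%E disk W
    (fun z => bergman_weight u w1 w2 z.1 z.2) (fun z => local_weight q 0 r a b z.1 z.2)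
    (4 * r `^ (- q)) (128 * r `^ 2 * dl `^ (- u)) _ _ mdisk (measurable_funTS mW)
    (measurable_funTS mbw) (measurable_funTS (measurable_local_weight q 0 r a b))
    W0 bw0 (fun z => local_weight_ge0 _ _ _ _ _ _ _) _ _ _ i1' (i3 a b r r0).
  move=> H; apply: le_trans (H _ _ _) _.
  + by rewrite mulr_ge0 ?powR_ge0.
  + by rewrite !mulr_ge0 ?powR_ge0.
  + move=> z Dz; have [h|h] := lerP (r / 2) (edist a b z.1 z.2).
    * by rewrite (le_trans (far z h))// lerDl !mulr_ge0 ?powR_ge0.
    * rewrite (le_trans ((near z Dz h).2 r8))// lerDr.
      by rewrite mulr_ge0// mulr_ge0// powR_ge0.
  rewrite lee_fin (_ : 128 * r `^ 2 * dl `^ (- u) * _ =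
    128 * C3 * ((r `^ 2 * r `^ (- 2 - q - 0)) * dl `^ (- u))); last by ring.
  rewrite rq (_ : 4 * _ * _ = 4 * C1 * (r `^ (- q) * dl `^ (- u))); last by ring.
  rewrite -mulrDl; apply: ler_wpM2r; first exact: X0.
  by rewrite lerD2r lerDl; exact: p.
- have := @integral_comb_le _ _ plane (leb \x leb)%E disk W
    (fun z => bergman_weight u w1 w2 z.1 z.2) (fun z => local_weight q u r a b z.1 z.2)
    (4 * r `^ (- q)) (64 * r `^ 2) _ _ mdisk (measurable_funTS mW)
    (measurable_funTS mbw) (measurable_funTS (measurable_local_weight q u r a b))
    W0 bw0 (fun z => local_weight_ge0 _ _ _ _ _ _ _) _ _ _ i1' (i2 a b r r0).
  move=> H; apply: le_trans (H _ _ _) _.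
  + by rewrite mulr_ge0 ?powR_ge0.
  + by rewrite !mulr_ge0 ?powR_ge0.
  + move=> z Dz; have [h|h] := lerP (r / 2) (edist a b z.1 z.2).
    * by rewrite (le_trans (far z h))// lerDl !mulr_ge0 ?powR_ge0.
    * rewrite (le_trans (near z Dz h).1)// lerDr.
      by rewrite mulr_ge0// mulr_ge0// powR_ge0.
  (* Here w is at most 8r from the boundary in terms of its defect, so the surplus power r^(-u) is
     absorbed by the defect. *)
  have ru : r `^ (- u) <= 8 * dl `^ (- u).
    have h : (8 * r) `^ (- u) <= dl `^ (- u).
      by apply: le0_ler_powR; rewrite ?oppr_le0 ?(ltW u0) ?(ltW r8).
    have -> : r `^ (- u) = 8 `^ u * (8 * r) `^ (- u).
      by rewrite powRM ?(ltW r0)// mulrA powRNK// mul1r.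
    apply: ler_pM; rewrite ?powR_ge0//.
    by rewrite -[leRHS]powRr1//; apply: ler_powR; lra.
  have rqu : r `^ 2 * r `^ (- 2 - q - u) = r `^ (- q) * r `^ (- u).
    by rewrite -!powRD_gt0//; congr (_ `^ _); ring.
  rewrite lee_fin (_ : 64 * r `^ 2 * _ =
    64 * C2 * (r `^ 2 * r `^ (- 2 - q - u))); last by ring.
  rewrite rqu (_ : 4 * _ * _ = 4 * C1 * (r `^ (- q) * dl `^ (- u))); last by ring.
  apply: (@le_trans _ _ (4 * C1 * (r `^ (- q) * dl `^ (- u)) +
      64 * C2 * (r `^ (- q) * (8 * dl `^ (- u))))).
    by rewrite lerD2l ler_wpM2l ?mulr_ge0// ler_wpM2l ?powR_ge0.
  rewrite (_ : 64 * C2 * _ = 512 * C2 * (r `^ (- q) * dl `^ (- u))); last by ring.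
  rewrite -mulrDl; apply: ler_wpM2r; first exact: X0.
  by rewrite lerDl; exact: p.
Qed.

End WeightedEstimates.

(** * Schur's test *)

Section Schur.
Local Open Scope classical_set_scope.
Local Open Scope ring_scope.
Context {R : realType}.

(* Integrated and optimized over l, this replaces Hoelder's inequality. *)
Lemma le_add_powR (p x l : R) : 1 < p -> 0 <= x -> 0 < l ->
  x <= l + l `^ (1 - p) * x `^ p.
Proof.
move=> p1 x0 l0; have [xl|lx] := leP x l.
  by rewrite (le_trans xl)// lerDl mulr_ge0 ?powR_ge0.
have xp : 0 < x := lt_trans l0 lx.
have {1}-> : x = x `^ (1 - p) * x `^ p.
  by rewrite -powRD_gt0// subrK powRr1.
apply: (@le_trans _ _ (l `^ (1 - p) * x `^ p)); last by rewrite lerDr ltW.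
rewrite ler_wpM2r ?powR_ge0//; apply: le0_ler_powR => //; last exact: ltW.
by rewrite subr_le0 ltW.
Qed.

(** The choice l^p = j/h makes l^(1-p) j equal to l h, so y <= (C+1) l h, and the p-th power of this
    is the claim. For j = 0, small l forces y = 0. *)
Lemma powR_le_of_interpolation (p y C h j : R) : 1 < p -> 0 <= y -> 0 <= C -> 0 < h -> 0 <= j ->
  (forall l, 0 < l -> y <= l * (C * h) + l `^ (1 - p) * j) ->
  y `^ p <= (C + 1) `^ p * h `^ (p - 1) * j.
Proof.
move=> p1 y0 C0 h0 j0 hy.
have p0 : 0 < p by exact: lt_trans p1.
have [j_gt0|] := ltP 0 j; last first.
  move=> j_le0; have {j0 j_le0} jE : j = 0 by apply/eqP; rewrite eq_le j_le0.
  rewrite jE mulr0 in hy *.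
  have Ch : 0 < C * h + 1 by rewrite ltr_wpDl// mulr_ge0// ltW.
  have -> : y = 0.
    apply/eqP; rewrite eq_le y0 andbT leNgt; apply/negP => yp.
    (* This l makes the hypothesis read y <= y/2 at best. *)
    have l0 : 0 < y / (C * h + 1) / 2 by rewrite !divr_gt0.
    have := hy _ l0; rewrite mulr0 addr0; apply/negP; rewrite -ltNge.
    have -> : y / (C * h + 1) / 2 * (C * h) = y / 2 * (C * h / (C * h + 1)) by ring.
    apply: (@le_lt_trans _ _ (y / 2 * 1)).
      rewrite ler_wpM2l ?divr_ge0// ler_pdivrMr// mul1r; lra.
    lra.
  by rewrite powR0 ?gt_eqF.
pose l := (j / h) `^ p^-1.
have jh : 0 < j / h by exact: divr_gt0.
have l0 : 0 < l by exact: powR_gt0.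
have lp : l `^ p = j / h by rewrite -powRrM mulVf ?gt_eqF// powRr1// ltW.
have e : l `^ (1 - p) * j = l * h.
  have -> : j = l `^ p * h by rewrite lp mulfVK// gt_eqF.
  by rewrite mulrA -powRD_gt0// subrK powRr1// ltW.
have := hy l l0; rewrite e => hyl.
have {}hyl : y <= (C + 1) * (l * h).
  by apply: le_trans hyl _; rewrite le_eqVlt; apply/orP; left; apply/eqP; ring.
have C1 : 0 <= C + 1 by rewrite addr_ge0.
have lh : 0 < l * h by exact: mulr_gt0.
have : y `^ p <= ((C + 1) * (l * h)) `^ p.
  by apply: ge0_ler_powR; rewrite ?nnegrE ?mulr_ge0 ?(ltW p0) ?(ltW l0) ?(ltW h0).
move=> /le_trans; apply.
rewrite powRM// ?(ltW lh)// powRM ?(ltW l0) ?(ltW h0)// lp.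
rewrite -!mulrA ler_wpM2l ?powR_ge0//.
have -> : h `^ p = h `^ (p - 1) * h by rewrite -{3}(powRr1 (ltW h0)) -powRD_gt0// subrK.
by rewrite le_eqVlt; apply/orP; left; apply/eqP; field; rewrite gt_eqF.
Qed.

Context d (T : measurableType d) (mu : {sigma_finite_measure set T -> \bar R}).
Variables (D : set T) (p : R) (k : T * T -> R) (H sigma F : T -> R) (C1 C2 : R).
Hypotheses (mD : measurable D) (p1 : 1 < p).
Hypotheses (mk : measurable_fun setT k) (k0 : forall z, 0 <= k z).
Hypotheses (mH : measurable_fun setT H) (H0 : forall z, D z -> 0 < H z).
Hypotheses (ms : measurable_fun setT sigma) (s0 : forall z, 0 <= sigma z).
Hypotheses (mF : measurable_fun setT F) (F0 : forall z, 0 <= F z).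
Hypotheses (C10 : 0 <= C1) (C20 : 0 <= C2).
Hypothesis S1 : forall w, D w ->
  (\int[mu]_(z in D) (k (w, z) * H z)%:E <= (C1 * H w)%:E)%E.
Hypothesis S2 : forall z, D z ->
  (\int[mu]_(w in D) (sigma w * H w `^ (p - 1) * k (w, z))%:E <=
    (C2 * (sigma z * H z `^ (p - 1)))%:E)%E.

Let J w := (\int[mu]_(z in D) (k (w, z) * (H z `^ (1 - p) * F z `^ p))%:E)%E.

Let mB : measurable_fun setT (fun z => H z `^ (1 - p) * F z `^ p).
Proof. by apply: measurable_funM; exact: measurable_powR_comp. Qed.

Let mk1 w : measurable_fun setT (fun z => k (w, z)).
Proof. by apply: (measurableT_comp mk); exact: measurable_pair1. Qed.

Let mk2 z : measurable_fun setT (fun w => k (w, z)).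
Proof. by apply: (measurableT_comp mk); exact: measurable_pair2. Qed.

(** [le_add_powR] at x = F/H, multiplied by k H and integrated, bounds y by l C1 H(w) + l^(1-p) J(w)
    for every l > 0, and l is then optimized. If J(w) is infinite the bound is trivial. *)
Lemma schur_pointwise w (y : R) : D w -> 0 <= y ->
  (y%:E <= \int[mu]_(z in D) (k (w, z) * F z)%:E)%E ->
  ((y `^ p)%:E <= ((C1 + 1) `^ p * H w `^ (p - 1))%:E * J w)%E.
Proof.
move=> Dw y0 yle.
have J0 : (0 <= J w)%E.
  by apply: integral_ge0 => z _; rewrite lee_fin !mulr_ge0 ?powR_ge0.
have hw := H0 Dw.
have c0 : 0 < (C1 + 1) `^ p * H w `^ (p - 1) by rewrite mulr_gt0 ?powR_gt0// ltr_wpDl.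
case EJ : (J w) J0 => [j| |] // j0; last by rewrite mulry gtr0_sg// mul1e leey.
rewrite -EFinM lee_fin; apply: powR_le_of_interpolation => // l l0.
rewrite -lee_fin; apply: le_trans yle _.
(* [integral_comb_le] asks for nonnegativity everywhere while [H] is known to be positive on [D]
   only, hence the absolute value. *)
apply: (@integral_comb_le _ _ _ mu D (fun z => k (w, z) * F z)
  (fun z => k (w, z) * `|H z|) (fun z => k (w, z) * (H z `^ (1 - p) * F z `^ p))) => //.
- by apply: measurable_funTS; exact: measurable_funM.
- by apply: measurable_funTS; apply: measurable_funM => //; exact: measurableT_comp.
- by apply: measurable_funTS; exact: measurable_funM.
- by move=> z; rewrite mulr_ge0.
- by move=> z; rewrite mulr_ge0.
- by move=> z; rewrite !mulr_ge0 ?powR_ge0.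
- exact: ltW.
- exact: powR_ge0.
- move=> z Dz; have hz := H0 Dz; rewrite gtr0_norm//.
  have := le_add_powR p1 (divr_ge0 (F0 z) (ltW hz)) l0.
  rewrite ler_pdivrMr// => h.
  rewrite mulrCA [X in _ + X]mulrCA -mulrDr ler_wpM2l// (le_trans h)//.
  rewrite mulrDl lerD2l -mulrA ler_wpM2l ?powR_ge0//.
  rewrite powRM ?invr_ge0 ?(ltW hz)// -(powR_inv1 (ltW hz)) -powRrM mulN1r.
  rewrite addrC (powRD_gt0 (- p) 1 hz) powRr1 ?(ltW hz)//.
  by rewrite le_eqVlt; apply/orP; left; apply/eqP; ring.
- rewrite (eq_integral (fun z => (k (w, z) * H z)%:E)); first exact: S1.
  by move=> z; rewrite inE => Dz; rewrite gtr0_norm// H0.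
- by rewrite -EJ.
Qed.

(** Only domination of y by the positive integral is asked, so the modulus of a complex operator
    qualifies. Integrating the pointwise bound against sigma and exchanging the integrals produces
    the left side of [S2]; the H^(p-1) it returns cancels the H^(1-p) inside [J]. *)
Lemma schur_test (y : T -> R) : measurable_fun D y -> (forall w, 0 <= y w) ->
  (forall w, D w -> (y w)%:E <= \int[mu]_(z in D) (k (w, z) * F z)%:E)%E ->
  (\int[mu]_(w in D) (y w `^ p * sigma w)%:E <=
    ((C1 + 1) `^ p * C2)%:E * \int[mu]_(z in D) (F z `^ p * sigma z)%:E)%E.
Proof.
move=> my y0 yle.
pose A w := sigma w * H w `^ (p - 1).
pose B z := H z `^ (1 - p) * F z `^ p.
have A0 w : 0 <= A w by rewrite mulr_ge0 ?powR_ge0.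
have B0 w : 0 <= B w by rewrite mulr_ge0 ?powR_ge0.
have mA : measurable_fun setT A by apply: measurable_funM => //; exact: measurable_powR_comp.
have mi : measurable_fun setT (\1_D : T -> R) by exact: measurable_indic.
(* The indicators move both integrals to the whole space, where Tonelli is applied. *)
pose Phi (x : T * T) : \bar R := ((\1_D x.1 * \1_D x.2 * (A x.1 * k x * B x.2) : R)%:E).
have mPhi : measurable_fun setT Phi.
  apply/measurable_EFinP; apply: measurable_funM; apply: measurable_funM.
  - exact: (measurableT_comp mi measurable_fst).
  - exact: (measurableT_comp mi measurable_snd).
  - by apply: measurable_funM => //; exact: (measurableT_comp mA measurable_fst).
  - exact: (measurableT_comp mB measurable_snd).
have i0 (z : T) : 0 <= \1_D z :> R by rewrite indicE.
have Phi0 x : (0 <= Phi x)%E.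
  by rewrite lee_fin; apply: mulr_ge0; [exact: mulr_ge0|apply: mulr_ge0 => //; exact: mulr_ge0].
pose Psi w := (\int[mu]_z Phi (w, z))%E.
have mPsi : measurable_fun setT Psi by exact: measurable_fun_fubini_tonelli_F.
have Psi0 w : (0 <= Psi w)%E by apply: integral_ge0.
have PsiE w : D w -> Psi w = ((A w)%:E * J w)%E.
  move=> Dw; rewrite /J -ge0_integralZl_EFin//; last 2 first.
  - by move=> z _; rewrite lee_fin mulr_ge0// B0.
  - apply/measurable_EFinP; apply: measurable_funTS; exact: measurable_funM.
  rewrite [RHS]integral_mkcond; apply: eq_integral => z _.
  rewrite /Phi/= patchE !indicE (mem_set Dw) mul1r.
  by have [zD|zD] := boolP (z \in D); rewrite ?mul1r ?mul0r// -EFinM -mulrA.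
pose K := (C1 + 1) `^ p.
have K0 : 0 <= K by exact: powR_ge0.
apply: (@le_trans _ _ (\int[mu]_(w in D) (K%:E * Psi w))%E).
  apply: ge0_le_integral => //.
  - by move=> w _; rewrite lee_fin mulr_ge0// powR_ge0.
  - apply/measurable_EFinP; apply: measurable_funM; last exact: measurable_funTS.
    exact: measurable_powR_comp.
  - by apply: measurable_funTS; apply: emeasurable_funM.
  - move=> w Dw; rewrite PsiE// EFinM.
    have := schur_pointwise Dw (y0 w) (yle w Dw).
    move=> h; rewrite [leLHS]muleC.
    apply: (le_trans (lee_wpmul2l _ h)); first by rewrite lee_fin.
    rewrite !muleA -!EFinM (_ : sigma w * _ = K * A w)//.
    by rewrite /A /K; ring.
rewrite ge0_integralZl_EFin//; last exact: measurable_funTS.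
rewrite [X in (_ <= X * _)%E]EFinM -muleA; apply: lee_wpmul2l; first by rewrite lee_fin.
apply: (@le_trans _ _ (\int[mu]_w Psi w)%E).
  by apply: ge0_subset_integral.
rewrite /Psi (fubini_tonelli Phi)//.
have mAB : measurable_fun D (fun z => (F z `^ p * sigma z)%:E).
  apply/measurable_EFinP; apply: measurable_funTS; apply: measurable_funM => //.
  exact: measurable_powR_comp.
rewrite -ge0_integralZl_EFin//; last first.
  by move=> z _; rewrite lee_fin mulr_ge0 ?powR_ge0.
rewrite [leRHS]integral_mkcond; apply: ge0_le_integral.
- exact: measurableT.
- by move=> z _; apply: integral_ge0.
- exact: (measurable_fun_fubini_tonelli_G Phi mPhi Phi0).
- by apply/(measurable_restrictT _ mD); exact: emeasurable_funM.
move=> z _; rewrite patchE; case: ifPn => zD; last first.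
  by rewrite integral0_eq// => w _; rewrite /Phi/= !indicE (negbTE zD) mulr0 mul0r.
have Dz : D z by rewrite inE in zD.
have -> : (\int[mu]_w Phi (w, z) = (B z)%:E * \int[mu]_(w in D) (A w * k (w, z))%:E)%E.
  rewrite -ge0_integralZl_EFin//; last 2 first.
  - by move=> w _; rewrite lee_fin mulr_ge0// A0.
  - apply/measurable_EFinP; apply: measurable_funTS; exact: measurable_funM.
  rewrite [RHS]integral_mkcond; apply: eq_integral => w _.
  rewrite /Phi/= patchE !indicE zD mulr1.
  by have [wD|wD] := boolP (w \in D); rewrite ?mul1r ?mul0r// -EFinM mulrC.
apply: (le_trans (lee_wpmul2l _ (S2 Dz))); first by rewrite lee_fin.
rewrite -!EFinM lee_fin /B.
have e : H z `^ (1 - p) * H z `^ (p - 1) = 1.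
  by rewrite -opprB mulrC powRNK// H0.
rewrite le_eqVlt; apply/orP; left; apply/eqP.
rewrite [LHS](_ : _ = C2 * (F z `^ p * sigma z) * (H z `^ (1 - p) * H z `^ (p - 1))); last by ring.
by rewrite e mulr1.
Qed.
End Schur.

(** * The Bergman kernel in real coordinates *)

Section ComplexCoordinates.
Local Open Scope classical_set_scope.
Local Open Scope ring_scope.
Local Open Scope complex_scope.
Context {R : realType}.
Local Notation leb := (@lebesgue_measure R).
Local Notation RT := (measurableTypeR R).
Local Notation plane := (RT * RT)%type.

Lemma cabsE (x y : R) : cabs (x +i* y) = Num.sqrt (x ^+ 2 + y ^+ 2).
Proof. by rewrite /cabs normc_def. Qed.

Lemma cabsM (x y : R[i]) : cabs (x * y) = cabs x * cabs y.
Proof.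
rewrite /cabs normrM; have [a _] : exists a, `|x| = a%:C /\ True.
  by exists (Num.sqrt (complex.Re x ^+ 2 + complex.Im x ^+ 2)); rewrite normc_def.
by rewrite !normc_def /= mulr0 subr0.
Qed.

Lemma cabs_ge0 (x : R[i]) : 0 <= cabs x.
Proof. by case: x => x y; rewrite cabsE sqrtr_ge0. Qed.

Lemma Re_le_cabs (x : R[i]) : `|complex.Re x| <= cabs x.
Proof.
case: x => x y; rewrite cabsE /= -sqrtr_sqr ler_wsqrtr// lerDl sqr_ge0 //.
Qed.

Lemma Im_le_cabs (x : R[i]) : `|complex.Im x| <= cabs x.
Proof.
case: x => x y; rewrite cabsE /= -sqrtr_sqr ler_wsqrtr// lerDr sqr_ge0 //.
Qed.

Lemma cabs_le_ReIm (x : R[i]) : cabs x <= `|complex.Re x| + `|complex.Im x|.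
Proof.
case: x => x y; rewrite cabsE /=.
have h : 0 <= `|x| + `|y| by rewrite addr_ge0.
rewrite -(ger0_norm h) -(sqrtr_sqr (`|x| + `|y|)) ler_wsqrtr//.
rewrite sqrrD !real_normK ?num_real// addrAC lerDl mulrn_wge0// mulr_ge0//.
Qed.

Lemma preimage_unit_disk : cplx @^-1` (@unit_disk R) = disk.
Proof.
apply/seteqP; split => z; rewrite /unit_disk /disk /cplx /= cabsE.
  by rewrite -[X in _ < X -> _]sqrtr1 ltr_sqrt.
by move=> h; rewrite -[X in _ < X]sqrtr1 ltr_sqrt.
Qed.

(** With 1 - w conj(z) = P - iQ the kernel is (P + iQ)^2 / (pi (P^2 + Q^2)^2). Explicit real and
    imaginary parts make its joint measurability in (w, z) evident. *)
Definition kernel_re (x : plane * plane) : R :=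
  pi^-1 * (kden x.1.1 x.1.2 x.2.1 x.2.2 `^ (- 1)) ^+ 2 *
  ((1 - (x.1.1 * x.2.1 + x.1.2 * x.2.2)) ^+ 2 - (x.1.2 * x.2.1 - x.1.1 * x.2.2) ^+ 2).

Definition kernel_im (x : plane * plane) : R :=
  pi^-1 * (kden x.1.1 x.1.2 x.2.1 x.2.2 `^ (- 1)) ^+ 2 *
  (2 * (1 - (x.1.1 * x.2.1 + x.1.2 * x.2.2)) * (x.1.2 * x.2.1 - x.1.1 * x.2.2)).

Lemma bergman_kernelE (w z : plane) :
  bergman_kernel (cplx w) (cplx z) = kernel_re (w, z) +i* kernel_im (w, z).
Proof.
rewrite /bergman_kernel /kernel_re /kernel_im /cplx /kden /=.
set a : R := w.1; set b : R := w.2; set x : R := z.1; set y : R := z.2.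
have pi0 : pi != 0 :> R by rewrite gt_eqF// pi_gt0.
set P := 1 - (a * x + b * y); set Q := b * x - a * y.
have -> : 1 - (a +i* b) * conjc (x +i* y) = P +i* (- Q).
  by apply/eqP; rewrite eq_complex /P /Q /=; apply/andP; split; apply/eqP; ring.
have N0 : 0 <= P ^+ 2 + Q ^+ 2 by rewrite addr_ge0 ?sqr_ge0.
rewrite powR_inv1//.
(* Where 1 - w conj(z) vanishes, both sides are 0 because the inverse of 0 is 0. *)
have [NE|NE] := eqVneq (P ^+ 2 + Q ^+ 2) 0.
  have : (P ^+ 2 == 0) && (Q ^+ 2 == 0) by rewrite -paddr_eq0 ?sqr_ge0// NE.
  rewrite !sqrf_eq0 => /andP[/eqP -> /eqP ->].
  apply/eqP; rewrite (_ : 0 +i* - 0 = 0); last first.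
    by apply/eqP; rewrite eq_complex /= oppr0 !eqxx.
  by rewrite expr0n/= mulr0 invr0 eq_complex /= !(mulr0, subrr, expr0n) /= !eqxx.
apply: mulr1_eq; apply/eqP; rewrite expr2 eq_complex /=.
move: (pi) pi0 => r r0.
by apply/andP; split; apply/eqP; field; rewrite NE r0.
Qed.

Lemma cabs_bergman_kernel (w z : plane) :
  cabs (bergman_kernel (cplx w) (cplx z)) = pi^-1 * kden w.1 w.2 z.1 z.2 `^ (- 1).
Proof.
have pi0 : 0 < pi :> R := pi_gt0 R.
have N0 : 0 <= kden w.1 w.2 z.1 z.2 by rewrite addr_ge0 ?sqr_ge0.
rewrite bergman_kernelE cabsE /kernel_re /kernel_im /=.
set k := _ `^ (- 1); set P := 1 - _; set Q := _ - w.1 * z.2.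
have kE : k = (P ^+ 2 + Q ^+ 2)^-1 by rewrite /k powR_inv1.
have k0 : 0 <= pi^-1 * k by rewrite mulr_ge0 ?powR_ge0// invr_ge0 ltW.
rewrite -[RHS]ger0_norm// -sqrtr_sqr; congr Num.sqrt.
have [NE|NE] := eqVneq (P ^+ 2 + Q ^+ 2) 0.
  rewrite kE NE invr0; ring.
rewrite kE; move: (pi) pi0 => r r0.
by field; rewrite NE gt_eqF.
Qed.

Lemma cabs_sub_edist (z : plane) (a : R[i]) :
  cabs (cplx z - a) = edist (complex.Re a) (complex.Im a) z.1 z.2.
Proof. by case: a => a b; rewrite /cplx cabsE. Qed.

Let m1 : measurable_fun setT (fun x : plane * plane => x.1.1 : R).
Proof. exact: (measurableT_comp measurable_plane_fst measurable_fst). Qed.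
Let m2 : measurable_fun setT (fun x : plane * plane => x.1.2 : R).
Proof. exact: (measurableT_comp measurable_plane_snd measurable_fst). Qed.
Let m3 : measurable_fun setT (fun x : plane * plane => x.2.1 : R).
Proof. exact: (measurableT_comp measurable_plane_fst measurable_snd). Qed.
Let m4 : measurable_fun setT (fun x : plane * plane => x.2.2 : R).
Proof. exact: (measurableT_comp measurable_plane_snd measurable_snd). Qed.

Let mP : measurable_fun setT
  (fun x : plane * plane => 1 - (x.1.1 * x.2.1 + x.1.2 * x.2.2) : R).
Proof. by apply: measurable_funB => //; apply: measurable_funD; exact: measurable_funM. Qed.

Let mQ : measurable_fun setT
  (fun x : plane * plane => x.1.2 * x.2.1 - x.1.1 * x.2.2 : R).
Proof. by apply: measurable_funB; exact: measurable_funM. Qed.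

Lemma measurable_kden2 : measurable_fun setT
  (fun x : plane * plane => kden x.1.1 x.1.2 x.2.1 x.2.2).
Proof. by apply: measurable_funD; exact: measurable_funX. Qed.

Let mk2 : measurable_fun setT
  (fun x : plane * plane => pi^-1 * (kden x.1.1 x.1.2 x.2.1 x.2.2 `^ (- 1)) ^+ 2).
Proof.
apply: measurable_funM => //; apply: measurable_funX; apply: measurable_powR_comp.
exact: measurable_kden2.
Qed.

Lemma measurable_kernel_re : measurable_fun setT kernel_re.
Proof. by apply: measurable_funM => //; apply: measurable_funB; exact: measurable_funX. Qed.

Lemma measurable_kernel_im : measurable_fun setT kernel_im.
Proof. by apply: measurable_funM => //; apply: measurable_funM => //; exact: measurable_funM. Qed.

(** Tonelli gives this for nonnegative integrands; the positive and negative parts are treated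
    separately, so no integrability is assumed. *)
Lemma measurable_integral_param d1 d2 (T1 : measurableType d1) (T2 : measurableType d2)
    (mu : {sigma_finite_measure set T2 -> \bar R}) (g : T1 * T2 -> \bar R) :
  measurable_fun setT g -> measurable_fun setT (fun w => \int[mu]_z g (w, z))%E.
Proof.
move=> mg.
rewrite (_ : (fun w => _) = fun w =>
   (\int[mu]_z (g ^\+) (w, z) - \int[mu]_z (g ^\-) (w, z))%E); last first.
  apply/funext => w; rewrite [LHS]integralE.
  congr (_ - _)%E; apply: eq_integral => z _.
    by rewrite !funeposE.
  by rewrite !funenegE.
apply: emeasurable_funB.
  exact: (measurable_fun_fubini_tonelli_F _ (measurable_funepos mg)).
exact: (measurable_fun_fubini_tonelli_F _ (measurable_funeneg mg)).
Qed.

End ComplexCoordinates.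

(** * Exponents, test function and convergence of the integral *)

Section PuncturedDisk.
Local Open Scope classical_set_scope.
Local Open Scope ring_scope.
Context {R : realType}.
Local Notation leb := (@lebesgue_measure R).
Local Notation RT := (measurableTypeR R).
Local Notation plane := (RT * RT)%type.

(** One of q1, q2 is 0, and u is an eighth of the gap between the other and 2. This is small enough
    because p - 1 < 8. *)
Lemma schur_exponents_exist (p : R) : 4 / 3 < p -> p < 4 ->
  exists q1 q2 u : R, [/\ 0 <= q1, 0 <= q2, q2 = p - 2 + q1 * (p - 1) &
    [/\ 0 < u, u < 1, q1 + u < 2, u * (p - 1) < 1 & q2 + u * (p - 1) < 2]].
Proof.
move=> p43 p4.
have [p2|p2] := lerP 2 p.
  exists 0, (p - 2), ((4 - p) / 8).
  split; [by []|lra|lra|split; nra].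
pose q := (2 - p) / (p - 1).
have p1 : 0 < p - 1 by lra.
have qE : q * (p - 1) = 2 - p by rewrite /q mulfVK// gt_eqF.
have q0 : 0 <= q by rewrite divr_ge0//; lra.
have q2 : q < 2 by rewrite ltr_pdivrMr//; lra.
exists q, 0, ((2 - q) / 8); split => //; first by rewrite qE; ring.
by split; nra.
Qed.

Variables (a b : R).

(* The point a is removed because the real power 0 `^ (- q) is 0, not +oo. *)
Definition pdisk : set plane := disk `\` [set ((a : RT), (b : RT))].

Lemma set1_plane (x y : RT) : [set (x, y)] = [set x] `*` [set y].
Proof. by apply/seteqP; split => [z ->|[z1 z2] [/= -> ->]]. Qed.

Lemma measurable_set1_plane (x y : RT) : measurable [set (x, y)].
Proof. by rewrite set1_plane; apply: measurableX; exact: measurable_set1. Qed.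

Lemma measurable_pdisk : measurable pdisk.
Proof. by apply: measurableD; [exact: measurable_disk|exact: measurable_set1_plane]. Qed.

Lemma integral_pdisk (f : plane -> R) : measurable_fun disk f -> (forall z, 0 <= f z) ->
  (\int[leb \x leb]_(z in disk) (f z)%:E = \int[leb \x leb]_(z in pdisk) (f z)%:E)%E.
Proof.
move=> mf f0; apply: ge0_negligible_integral.
- exact: measurable_set1_plane.
- exact: measurable_disk.
- exact/measurable_EFinP.
- by move=> z _; rewrite lee_fin.
rewrite set1_plane; apply: etrans (product_measure1E leb leb _ _) _.
- exact: measurable_set1.
- exact: measurable_set1.
- by rewrite [X in (X * _)%E]lebesgue_measure_set1 mul0e.
Qed.

Lemma edist_gt0 (x y : R) : (x, y) <> (a, b) -> 0 < edist a b x y.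
Proof.
move=> h; rewrite sqrtr_gt0 lt_neqAle eq_sym addr_ge0 ?sqr_ge0// andbT.
apply/negP; rewrite paddr_eq0 ?sqr_ge0// !sqrf_eq0 !subr_eq0 => /andP[/eqP xa /eqP yb].
by apply: h; rewrite xa yb.
Qed.

Lemma disk_defect (z : plane) : disk z -> 0 < defect z.1 z.2.
Proof. by rewrite /disk /defect /= subr_gt0. Qed.

Lemma pdisk_defect (z : plane) : pdisk z -> 0 < defect z.1 z.2.
Proof. by case=> /disk_defect. Qed.

Lemma pdisk_edist (z : plane) : pdisk z -> 0 < edist a b z.1 z.2.
Proof. by case: z => x y [_ h]; apply: edist_gt0. Qed.

(** |1 - w conj(z)|^2 = (1+|w|^2)(1+|z|^2) - |w+z|^2. The bound keeps the kernel away from 0, so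
    that integrals against it control plain integrals. *)
Lemma kden_le4 (x1 y1 x2 y2 : R) : 0 < defect x1 y1 -> 0 < defect x2 y2 ->
  kden x1 y1 x2 y2 <= 4.
Proof.
rewrite /defect !subr_gt0 => h1 h2.
have n1 : 0 <= x1 ^+ 2 + y1 ^+ 2 by rewrite addr_ge0 ?sqr_ge0.
have n2 : 0 <= x2 ^+ 2 + y2 ^+ 2 by rewrite addr_ge0 ?sqr_ge0.
have n3 : 0 <= (x1 + x2) ^+ 2 + (y1 + y2) ^+ 2 by rewrite addr_ge0 ?sqr_ge0.
have n4 : (x1 ^+ 2 + y1 ^+ 2) * (x2 ^+ 2 + y2 ^+ 2) <= 1 * 1 by apply: ler_pM => //; exact: ltW.
have -> : kden x1 y1 x2 y2 = 1 + (x1 ^+ 2 + y1 ^+ 2) + (x2 ^+ 2 + y2 ^+ 2)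
  + (x1 ^+ 2 + y1 ^+ 2) * (x2 ^+ 2 + y2 ^+ 2) - ((x1 + x2) ^+ 2 + (y1 + y2) ^+ 2).
  by rewrite /kden; ring.
move: n3 n4 h1 h2; set A := _ * _; set B := x1 ^+ 2 + _; set C := x2 ^+ 2 + _.
set D := _ + (y1 + y2) ^+ 2; lra.
Qed.

Lemma edist_le2 (z : plane) : 0 < defect a b -> disk z -> edist a b z.1 z.2 <= 2.
Proof.
move=> dab /disk_defect dz.
have -> : 2 = Num.sqrt (2 ^+ 2) :> R by rewrite sqrtr_sqr ger0_norm.
rewrite ler_wsqrtr//; move: dab dz; case: z => x y /=; rewrite /defect => h1 h2.
have n3 : 0 <= (x + a) ^+ 2 + (y + b) ^+ 2 by rewrite addr_ge0 ?sqr_ge0.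
have -> : (x - a) ^+ 2 + (y - b) ^+ 2 = 2 * (x ^+ 2 + y ^+ 2) + 2 * (a ^+ 2 + b ^+ 2)
  - ((x + a) ^+ 2 + (y + b) ^+ 2) by ring.
move: n3 h1 h2; set A := x ^+ 2 + _; set B := a ^+ 2 + _; set D := _ + (y + b) ^+ 2; lra.
Qed.

Lemma pdisk_nonempty : exists w0, pdisk w0.
Proof.
have [/eqP [a0 b0]|ab] := boolP (((a, b) : R * R) == (0, 0)).
  exists ((2^-1 : R), (0 : R)); split; rewrite /disk /=.
    by rewrite expr0n/= addr0 exprVn invf_lt1//; lra.
  by case=> /eqP; rewrite a0 invr_eq0 pnatr_eq0.
exists ((0 : R), (0 : R)); split; rewrite /disk /=.
  by rewrite expr0n/= addr0.
by move=> e; move/negP: ab; apply; rewrite -e.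
Qed.

Variables (p q1 q2 u : R).
Hypotheses (p1 : 1 < p) (q10 : 0 <= q1) (q20 : 0 <= q2)
  (q12 : q2 = p - 2 + q1 * (p - 1)) (u0 : 0 < u).

Definition edist_weight (z : plane) : R := edist a b z.1 z.2 `^ (2 - p).

Definition testfun (z : plane) : R :=
  edist a b z.1 z.2 `^ (- q1) * defect z.1 z.2 `^ (- u).

Definition kden_inv (x : plane * plane) : R := kden x.1.1 x.1.2 x.2.1 x.2.2 `^ (- 1).

Lemma measurable_edist_weight : measurable_fun setT edist_weight.
Proof. by apply: measurable_powR_comp; exact: measurable_edist. Qed.

Lemma measurable_testfun : measurable_fun setT testfun.
Proof.
by apply: measurable_funM; apply: measurable_powR_comp;
  [exact: measurable_edist|exact: measurable_defect].
Qed.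

Lemma measurable_kden_inv : measurable_fun setT kden_inv.
Proof. by apply: measurable_powR_comp; exact: measurable_kden2. Qed.

Lemma testfun_gt0 z : pdisk z -> 0 < testfun z.
Proof.
by move=> h; rewrite mulr_gt0// powR_gt0; [|exact: pdisk_edist| |exact: pdisk_defect].
Qed.

(** By the relation [q12] the second Schur condition becomes the weighted estimate again, with
    exponents q2 and u(p-1). *)
Lemma edist_weight_testfun z : pdisk z -> edist_weight z * testfun z `^ (p - 1) =
  edist a b z.1 z.2 `^ (- q2) * defect z.1 z.2 `^ (- (u * (p - 1))).
Proof.
move=> Dz; have r0 := pdisk_edist Dz.
rewrite /edist_weight /testfun powRM ?powR_ge0// -!powRrM mulrA -powRD_gt0// mulNr.
by congr (_ `^ _ * _ `^ _); rewrite ?q12; ring.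
Qed.

Lemma testfun_le_edist_weight z : 0 < defect a b -> pdisk z ->
  testfun z `^ (1 - p) <= 2 `^ q2 * edist_weight z.
Proof.
move=> dab Dz; have r0 := pdisk_edist Dz; have d0 := pdisk_defect Dz.
rewrite /edist_weight /testfun powRM ?powR_ge0// -!powRrM.
have -> : - q1 * (1 - p) = q2 + (2 - p) by rewrite q12; ring.
rewrite powRD_gt0// -[leRHS]mulr1; apply: ler_pM; rewrite ?mulr_ge0 ?powR_ge0//.
  rewrite ler_wpM2r ?powR_ge0//; apply: ge0_ler_powR; rewrite ?nnegrE ?(ltW r0)//.
  by apply: edist_le2 => //; case: Dz.
have -> : - u * (1 - p) = u * (p - 1) by ring.
apply: (@le_trans _ _ (1 `^ (u * (p - 1)))); last by rewrite powR1.
apply: ge0_ler_powR; rewrite ?nnegrE ?(ltW d0)//.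
  by rewrite mulr_ge0// ?subr_ge0 ltW.
by rewrite /defect gerBl addr_ge0 ?sqr_ge0.
Qed.

Variables (C1 C2 : R).
Hypotheses (C10 : 0 <= C1) (C20 : 0 <= C2).
Hypothesis B1 : forall w1 w2, 0 < defect w1 w2 -> 0 < edist a b w1 w2 ->
  (\int[leb \x leb]_(z in disk)
      (edist a b z.1 z.2 `^ (- q1) * bergman_weight u w1 w2 z.1 z.2)%:E
    <= (C1 * (edist a b w1 w2 `^ (- q1) * defect w1 w2 `^ (- u)))%:E)%E.
Hypothesis B2 : forall w1 w2, 0 < defect w1 w2 -> 0 < edist a b w1 w2 ->
  (\int[leb \x leb]_(z in disk)
      (edist a b z.1 z.2 `^ (- q2) * bergman_weight (u * (p - 1)) w1 w2 z.1 z.2)%:E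
    <= (C2 * (edist a b w1 w2 `^ (- q2) * defect w1 w2 `^ (- (u * (p - 1)))))%:E)%E.

Let mweight q v w1 w2 : measurable_fun setT
  (fun z : plane => edist a b z.1 z.2 `^ (- q) * bergman_weight v w1 w2 z.1 z.2).
Proof.
apply: measurable_funM; last exact: measurable_bergman_weight.
by apply: measurable_powR_comp; exact: measurable_edist.
Qed.

Let weight0 q v w1 w2 (z : plane) :
  0 <= edist a b z.1 z.2 `^ (- q) * bergman_weight v w1 w2 z.1 z.2.
Proof. by rewrite mulr_ge0 ?powR_ge0// mulr_ge0 ?powR_ge0. Qed.

Lemma schur_condition1 w : pdisk w ->
  (\int[leb \x leb]_(z in pdisk) (kden_inv (w, z) * testfun z)%:E <= (C1 * testfun w)%:E)%E.
Proof.
move=> Dw; have := B1 (pdisk_defect Dw) (pdisk_edist Dw).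
rewrite (integral_pdisk (measurable_funTS (mweight _ _ _ _)) (weight0 _ _ _ _)).
rewrite (eq_integral (fun z => (kden_inv (w, z) * testfun z)%:E))// => z _.
by rewrite /kden_inv /testfun /bergman_weight; congr EFin; ring.
Qed.

Lemma schur_condition2 z : pdisk z ->
  (\int[leb \x leb]_(w in pdisk) (edist_weight w * testfun w `^ (p - 1) * kden_inv (w, z))%:E
    <= (C2 * (edist_weight z * testfun z `^ (p - 1)))%:E)%E.
Proof.
move=> Dz; have := B2 (pdisk_defect Dz) (pdisk_edist Dz).
rewrite (integral_pdisk (measurable_funTS (mweight _ _ _ _)) (weight0 _ _ _ _)).
rewrite -(edist_weight_testfun Dz).
rewrite (eq_integral (fun w => (edist_weight w * testfun w `^ (p - 1) * kden_inv (w, z))%:E))// => w.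
rewrite inE => Dw; rewrite (edist_weight_testfun Dw) /kden_inv /bergman_weight kden_sym.
by congr EFin; ring.
Qed.

(** For fixed w the kernel is at most [c], so F only has to be integrable, and F <= H + H^(1-p) F^p.
    The last term is at most 2^q2 times the weighted integrand. For H the first Schur condition is
    used at an auxiliary point [w0], since w itself may be the removed point. *)
Lemma integral_kernel_lty (F : plane -> R) w : 0 < defect a b -> disk w ->
  measurable_fun disk F -> (forall z, 0 <= F z) ->
  (\int[leb \x leb]_(z in disk) (F z `^ p * edist_weight z)%:E < +oo)%E ->
  (\int[leb \x leb]_(z in disk) (kden_inv (w, z) * F z)%:E < +oo)%E.
Proof.
move=> dab Dw mF F0 IF.
have mFp : measurable_fun disk (fun z => F z `^ p * edist_weight z).
  apply: measurable_funM; first exact: measurable_powR_comp.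
  by apply: measurable_funTS; exact: measurable_edist_weight.
have Fp0 z : 0 <= F z `^ p * edist_weight z by rewrite mulr_ge0 ?powR_ge0.
have mk v : measurable_fun setT (fun z : plane => kden_inv (v, z)).
  by apply: (measurableT_comp measurable_kden_inv); exact: measurable_pair1.
have mkF : measurable_fun disk (fun z => kden_inv (w, z) * F z).
  by apply: measurable_funM => //; exact: measurable_funTS.
have spd : pdisk `<=` disk by move=> z [].
have md := measurable_disk.
rewrite integral_pdisk//; last by move=> z; rewrite mulr_ge0 ?powR_ge0.
move: IF; rewrite integral_pdisk// => IF.
have [w0 Dw0] := pdisk_nonempty.
have dw := disk_defect Dw.
pose c := ((defect w.1 w.2 / 2) ^+ 2)^-1.
have c0 : 0 <= c by rewrite invr_ge0 sqr_ge0.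
have kw z : pdisk z -> kden_inv (w, z) <= c.
  move=> Dz; have dz := pdisk_defect Dz; have N0 := kden_gt0 dw dz.
  rewrite /kden_inv /= powR_inv1 ?(ltW N0)// /c lef_pV2 ?posrE ?exprn_gt0 ?divr_gt0//.
  apply: le_trans (kden_ge_defect dw dz).
  have h : defect w.1 w.2 / 2 <= (defect w.1 w.2 + defect z.1 z.2) / 2.
    by rewrite ler_wpM2r ?invr_ge0// lerDl ltW.
  have h0 : 0 <= defect w.1 w.2 / 2 by rewrite divr_ge0// ltW.
  by rewrite ler_sqr ?nnegrE// (le_trans h0).
(* Inserting this factor turns the integral of the test function into one bounded by
   [C1 * testfun w0]. *)
have kw0 z : pdisk z -> 1 <= 4 * kden_inv (w0, z).
  move=> Dz; have dz := pdisk_defect Dz; have dw0 := pdisk_defect Dw0.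
  have N0 := kden_gt0 dw0 dz.
  rewrite /kden_inv /= powR_inv1 ?(ltW N0)// ler_pdivlMr// mul1r.
  exact: kden_le4.
have I0 : (0 <= \int[leb \x leb]_(z in pdisk) (F z `^ p * edist_weight z)%:E)%E.
  by apply: integral_ge0 => v _; rewrite lee_fin.
have Ile : (\int[leb \x leb]_(z in pdisk) (F z `^ p * edist_weight z)%:E <=
  (fine (\int[leb \x leb]_(z in pdisk) (F z `^ p * edist_weight z)%:E))%:E)%E.
  by rewrite fineK// ge0_fin_numE.
have := @integral_comb_le _ _ plane (leb \x leb)%E pdisk
  (fun z => kden_inv (w, z) * F z) (fun z => kden_inv (w0, z) * `|testfun z|)
  (fun z => F z `^ p * edist_weight z) (4 * c) (c * 2 `^ q2) (C1 * testfun w0) _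
  measurable_pdisk.
move=> H; apply: le_lt_trans (H _ _ _ _ _ _ _ _ _ _ _ Ile) _.
- exact: measurable_funS mkF.
- apply: measurable_funTS; apply: measurable_funM => //.
  by apply: measurableT_comp => //; exact: measurable_testfun.
- exact: measurable_funS mFp.
- by move=> z; rewrite mulr_ge0 ?powR_ge0.
- by move=> z; rewrite mulr_ge0 ?powR_ge0.
- exact: Fp0.
- exact: mulr_ge0.
- by rewrite mulr_ge0 ?powR_ge0.
- move=> z Dz; have hz := testfun_gt0 Dz; rewrite (gtr0_norm hz).
  have := le_add_powR p1 (divr_ge0 (F0 z) (ltW hz)) (@ltr01 R).
  rewrite powR1 mul1r ler_pdivrMr// => hF.
  have e : (F z / testfun z) `^ p * testfun z = testfun z `^ (1 - p) * F z `^ p.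
    rewrite powRM ?invr_ge0 ?(ltW hz)// -(powR_inv1 (ltW hz)) -powRrM mulN1r.
    by rewrite (addrC 1) (powRD_gt0 (- p) 1 hz) powRr1 ?(ltW hz)//; ring.
  rewrite mulrDl mul1r e in hF.
  have h1 := testfun_le_edist_weight dab Dz.
  apply: (@le_trans _ _ (c * (testfun z + 2 `^ q2 * edist_weight z * F z `^ p))).
    apply: ler_pM; rewrite ?powR_ge0 ?kw//; apply: le_trans hF _.
    by rewrite lerD2l ler_wpM2r ?powR_ge0.
  rewrite mulrDr; apply: lerD; last by rewrite le_eqVlt; apply/orP; left; apply/eqP; ring.
  rewrite [leRHS](_ : _ = (c * testfun z) * (4 * kden_inv (w0, z))); last by ring.
  by rewrite ler_peMr ?kw0// mulr_ge0// ltW.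
- rewrite (eq_integral (fun z => (kden_inv (w0, z) * testfun z)%:E)).
    exact: schur_condition1.
  by move=> z; rewrite inE => Dz; rewrite gtr0_norm// testfun_gt0.
- exact: ltry.
Qed.

End PuncturedDisk.

Section SigmaFiniteArea.
Local Open Scope classical_set_scope.

Lemma sigma_finite_area (R : realType) : sigma_finite setT (@area R).
Proof.
have /sigma_finiteP[F [TF ndF Foo]] := sigma_finiteT (@lebesgue_measure R).
exists (fun n => F n `*` F n).
  rewrite -setXTT TF predeqE => -[x y]; split.
    move=> [/= [n _ Fnx] [k _ Fky]]; exists (maxn n k) => //; split.
    - by move: x Fnx; exact/subsetPset/ndF/leq_maxl.
    - by move: y Fky; exact/subsetPset/ndF/leq_maxr.
  by move=> [n _ []/= ? ?]; split; exists n.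
move=> k; have [? ?] := Foo k.
split; first exact: measurableX.
by rewrite /area product_measure1E// lte_mul_pinfty// ge0_fin_numE.
Qed.

End SigmaFiniteArea.

(* The canonical sigma-finite structure on products is unavailable here: on
   product_measure1 the library infers the one for finite factors. *)
HB.instance Definition _ (R : realType) :=
  Measure_isSigmaFinite.Build _ _ _ (@area R) (@sigma_finite_area R).

(** * Measurability and pointwise domination of the projection *)

Section BergmanProjection.
Local Open Scope classical_set_scope.
Local Open Scope ring_scope.
Context {R : realType}.
Local Notation leb := (@lebesgue_measure R).
Local Notation RT := (measurableTypeR R).
Local Notation plane := (RT * RT)%type.
Local Notation dsk := (cplx @^-1` (@unit_disk R)).

Lemma area_integral (g : plane -> \bar R) :
  (\int[area]_(z in dsk) g z = \int[leb \x leb]_(z in disk) g z)%E.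
Proof. by rewrite preimage_unit_disk. Qed.

Variable f : R[i] -> R[i].

(* To be used with part = Re and part = Im. *)
Section Part.
Variables (part : R[i] -> R) (phi : plane * plane -> R).
Hypothesis part_le : forall x, `|part x| <= cabs x.
Hypothesis mphi : measurable_fun setT phi.
Hypothesis phiE : forall w z, disk z ->
  part (bergman_kernel (cplx w) (cplx z) * f (cplx z)) = phi (w, z).
Hypothesis phi0 : forall w z, ~ disk z -> phi (w, z) = 0.

Let g w (z : plane) : R := part (bergman_kernel (cplx w) (cplx z) * f (cplx z)).

Lemma part_integralE w :
  (\int[area]_(z in dsk) (g w z)%:E = \int[leb \x leb]_z (phi (w, z))%:E)%E.
Proof.
rewrite area_integral integral_mkcond; apply: eq_integral => z _.
rewrite patchE; case: ifPn => [|zD]; first by rewrite inE => zD; rewrite /g phiE.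
by rewrite phi0//; move/negP: zD; rewrite inE.
Qed.

Lemma measurable_part_integral :
  measurable_fun setT (fun w => Rintegral (@area R) dsk (g w)).
Proof.
rewrite (_ : (fun w => _) = fine \o (fun w => \int[leb \x leb]_z (phi (w, z))%:E)%E).
  have mE : measurable_fun setT (EFin \o phi) by exact/measurable_EFinP.
  have mI := measurable_integral_param (@area R) mE.
  exact: (measurableT_comp (@fine_measurable R setT measurableT) mI).
by apply/funext => w; rewrite /Rintegral /= part_integralE.
Qed.

Lemma measurable_part w : measurable_fun disk (fun z => (g w z)%:E).
Proof.
apply: (eq_measurable_fun (fun z => (phi (w, z))%:E)).
  by move=> z; rewrite inE => Dz; rewrite /g phiE.
apply: measurable_funTS; apply/measurable_EFinP.
by apply: (measurableT_comp mphi); exact: measurable_pair1.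
Qed.

Hypothesis mmod : measurable_fun disk (fun z : plane => cabs (f (cplx z))).

Lemma integral_part_le w :
  (\int[leb \x leb]_(z in disk) `|(g w z)%:E| <=
   (pi^-1)%:E * \int[leb \x leb]_(z in disk) (kden_inv (w, z) * cabs (f (cplx z)))%:E)%E.
Proof.
have mk : measurable_fun setT (fun z : plane => kden_inv (w, z)).
  by apply: (measurableT_comp measurable_kden_inv); exact: measurable_pair1.
have mkf : measurable_fun disk (fun z : plane => kden_inv (w, z) * cabs (f (cplx z))).
  by apply: measurable_funM => //; exact: measurable_funTS.
have md := @measurable_disk R.
have pi0 : 0 <= pi^-1 :> R by rewrite invr_ge0 pi_ge0.
rewrite -ge0_integralZl_EFin//; last 2 first.
- by move=> z _; rewrite lee_fin mulr_ge0 ?powR_ge0 ?cabs_ge0.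
- exact/measurable_EFinP.
apply: ge0_le_integral.
- exact: md.
- by move=> z _; exact: abse_ge0.
- apply: measurableT_comp; [exact: abse_measurable|exact: measurable_part].
- by apply: emeasurable_funM; [exact: measurable_cst|exact/measurable_EFinP].
move=> z Dz; rewrite -EFinM lee_fin; apply: le_trans (part_le _) _.
by rewrite cabsM cabs_bergman_kernel /kden_inv /= mulrA.
Qed.

Lemma Rintegral_part_le w :
  ((`|Rintegral (@area R) dsk (g w)|)%:E <=
   (pi^-1)%:E * \int[leb \x leb]_(z in disk) (kden_inv (w, z) * cabs (f (cplx z)))%:E)%E.
Proof.
apply: le_trans (integral_part_le w).
rewrite /Rintegral area_integral.
apply: le_trans (le_abse_integral _ (@measurable_disk R) (measurable_part w)).
(* An infinite integral is sent to 0 by [fine], so the bound holds without integrability. *)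
by case: (integral _ _ _) => [r| |] //=; rewrite normr0 leey.
Qed.

Lemma integrable_part w :
  (\int[leb \x leb]_(z in disk) (kden_inv (w, z) * cabs (f (cplx z)))%:E < +oo)%E ->
  (@area R).-integrable dsk (fun z => (g w z)%:E).
Proof.
move=> h; apply/integrableP; split.
  by rewrite preimage_unit_disk; exact: measurable_part.
rewrite area_integral; apply: le_lt_trans (integral_part_le w) _.
by rewrite lte_mul_pinfty// lee_fin invr_ge0 pi_ge0.
Qed.

End Part.

Hypothesis mf : cmeasurable_fun unit_disk f.

Let fr (z : plane) : R := complex.Re (f (cplx z)).
Let fi (z : plane) : R := complex.Im (f (cplx z)).

Let mfr : measurable_fun disk fr.
Proof. by have [h _] := mf; rewrite preimage_unit_disk in h. Qed.

Let mfi : measurable_fun disk fi.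
Proof. by have [_ h] := mf; rewrite preimage_unit_disk in h. Qed.

Lemma measurable_cabs : measurable_fun disk (fun z : plane => cabs (f (cplx z))).
Proof.
apply: (eq_measurable_fun (fun z => Num.sqrt (fr z ^+ 2 + fi z ^+ 2))).
  by move=> z _; rewrite /fr /fi; case: (f (cplx z)) => x y; rewrite cabsE.
apply: (measurableT_comp (continuous_measurable_fun (@sqrt_continuous R))).
by apply: measurable_funD; exact: measurable_funX.
Qed.

(** Extending f by 0 off the disk yields a function measurable on the whole product, as parametric
    integration demands. *)
Let phir (x : plane * plane) : R :=
  kernel_re x * (fr \_ disk) x.2 - kernel_im x * (fi \_ disk) x.2.
Let phii (x : plane * plane) : R :=
  kernel_re x * (fi \_ disk) x.2 + kernel_im x * (fr \_ disk) x.2.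

Let mrestr (h : plane -> R) : measurable_fun disk h ->
  measurable_fun setT (fun x : plane * plane => (h \_ disk) x.2).
Proof.
move=> mh; apply: measurableT_comp; last exact: measurable_snd.
by apply/(measurable_restrictT _ (@measurable_disk R)).
Qed.

Let mphir : measurable_fun setT phir.
Proof.
apply: measurable_funB; apply: measurable_funM; try exact: mrestr.
  exact: measurable_kernel_re.
exact: measurable_kernel_im.
Qed.

Let mphii : measurable_fun setT phii.
Proof.
apply: measurable_funD; apply: measurable_funM; try exact: mrestr.
  exact: measurable_kernel_re.
exact: measurable_kernel_im.
Qed.

Let phirE w z : disk z ->
  complex.Re (bergman_kernel (cplx w) (cplx z) * f (cplx z)) = phir (w, z).
Proof.
move=> Dz; rewrite /phir !patchE /= (mem_set Dz) bergman_kernelE /fr /fi.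
by case: (f (cplx z)).
Qed.

Let phiiE w z : disk z ->
  complex.Im (bergman_kernel (cplx w) (cplx z) * f (cplx z)) = phii (w, z).
Proof.
move=> Dz; rewrite /phii !patchE /= (mem_set Dz) bergman_kernelE /fr /fi.
by case: (f (cplx z)).
Qed.

Let phir0 w z : ~ disk z -> phir (w, z) = 0.
Proof. by move=> Dz; rewrite /phir !patchE /= memNset// !mulr0 subrr. Qed.

Let phii0 w z : ~ disk z -> phii (w, z) = 0.
Proof. by move=> Dz; rewrite /phii !patchE /= memNset// !mulr0 addr0. Qed.

Lemma cintegrable_bergman (w : plane) :
  (\int[leb \x leb]_(z in disk) (kden_inv (w, z) * cabs (f (cplx z)))%:E < +oo)%E ->
  cintegrable unit_disk (fun eta => bergman_kernel (cplx w) eta * f eta).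
Proof.
move=> h; split.
- exact: (integrable_part Re_le_cabs mphir phirE measurable_cabs h).
- exact: (integrable_part Im_le_cabs mphii phiiE measurable_cabs h).
Qed.

Lemma measurable_bergman_Re :
  measurable_fun setT (fun w : plane => complex.Re (bergman f (cplx w))).
Proof. exact: (measurable_part_integral mphir phirE phir0). Qed.

Lemma measurable_bergman_Im :
  measurable_fun setT (fun w : plane => complex.Im (bergman f (cplx w))).
Proof. exact: (measurable_part_integral mphii phiiE phii0). Qed.

Lemma cmeasurable_bergman : cmeasurable_fun unit_disk (bergman f).
Proof.
split; apply: measurable_funTS.
- exact: measurable_bergman_Re.
- exact: measurable_bergman_Im.
Qed.

(** Bounding the modulus by the sum of both parts loses a factor 2, which the 1/pi of the kernel
    absorbs as pi >= 2. *)
Lemma cabs_bergman_le (w : plane) : ((cabs (bergman f (cplx w)))%:E <=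
  \int[leb \x leb]_(z in disk) (kden_inv (w, z) * cabs (f (cplx z)))%:E)%E.
Proof.
set I := integral _ _ _.
have I0 : (0 <= I)%E.
  by apply: integral_ge0 => z _; rewrite lee_fin mulr_ge0 ?powR_ge0 ?cabs_ge0.
have hr := Rintegral_part_le Re_le_cabs mphir phirE measurable_cabs w.
have hi := Rintegral_part_le Im_le_cabs mphii phiiE measurable_cabs w.
apply: (@le_trans _ _ ((pi^-1)%:E * I + (pi^-1)%:E * I)%E).
  apply: le_trans (leeD hr hi).
  by rewrite -EFinD lee_fin; exact: cabs_le_ReIm.
rewrite -ge0_muleDl ?lee_fin ?invr_ge0 ?pi_ge0// -EFinD.
rewrite -[leRHS]mul1e lee_wpmul2r// lee_fin.
have := pi_ge2 R; have := pi_gt0 R; move: (pi) => r r0 r2.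
have : r^-1 <= 2^-1 by rewrite lef_pV2 ?posrE.
lra.
Qed.

End BergmanProjection.

(** * The uniform weighted bound and the theorem *)

Section WeightedBound.
Local Open Scope classical_set_scope.
Local Open Scope ring_scope.
Context {R : realType}.
Local Notation leb := (@lebesgue_measure R).
Local Notation RT := (measurableTypeR R).
Local Notation plane := (RT * RT)%type.

Definition power_integral (p : R) (a : R[i]) (f : R[i] -> R[i]) : \bar R :=
  (\int[leb \x leb]_(z in disk)
    (cabs (f (cplx z)) `^ p * edist_weight (complex.Re a) (complex.Im a) p z)%:E)%E.

Lemma weighted_normE (p : R) (a : R[i]) f :
  weighted_norm p (dist_weight p a) f = (power_integral p a f `^ p^-1)%E.
Proof.
rewrite /weighted_norm /power_integral.
apply: (congr1 (fun I : \bar R => (I `^ p^-1)%E)); rewrite preimage_unit_disk.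
by apply: eq_integral => z _; rewrite /dist_weight cabs_sub_edist.
Qed.

Lemma power_integral_ge0 (p : R) (a : R[i]) f : (0 <= power_integral p a f)%E.
Proof. by apply: integral_ge0 => z _; rewrite lee_fin mulr_ge0 ?powR_ge0. Qed.

(** The constant is fixed before the centre a: [C1] and [C2] come from estimates uniform in a, which
    is the source of the uniformity in [w2]. *)
Lemma bergman_power_integral_le (p : R) : 4 / 3 < p -> p < 4 ->
  exists2 C : R, 0 <= C & forall a : R[i], unit_disk a ->
    forall f, cmeasurable_fun unit_disk f -> (power_integral p a f < +oo)%E ->
    (forall w, unit_disk w ->
      cintegrable unit_disk (fun eta => bergman_kernel w eta * f eta)) /\
    (power_integral p a (bergman f) <= C%:E * power_integral p a f)%E.
Proof.
move=> p43 p4.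
have p1 : 1 < p by lra.
have [q1 [q2 [u [q10 q20 q12 [u0 u1 qu1 v1 qv2]]]]] := schur_exponents_exist p43 p4.
have v0 : 0 < u * (p - 1) by rewrite mulr_gt0// subr_gt0.
have [C1 C10 B1] := integral_weighted_bergman_weight_le q10 u0 u1 qu1.
have [C2 C20 B2] := integral_weighted_bergman_weight_le q20 v0 v1 qv2.
exists ((C1 + 1) `^ p * C2); first by rewrite mulr_ge0 ?powR_ge0.
move=> a Da f mf If.
have mc := measurable_cabs mf.
have inD (w : R[i]) : unit_disk w -> exists2 z : plane, disk z & w = cplx z.
  case: w => x y h; exists ((x : RT), (y : RT)) => //.
  by rewrite -preimage_unit_disk.
have [[a1 a2] Dab aE] := inD _ Da.
have dab : 0 < defect a1 a2 by exact: (disk_defect Dab).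
have S1 := schur_condition1 (B1 a1 a2).
have S2 := schur_condition2 q12 (B2 a1 a2).
rewrite /power_integral aE /= in If *.
have F0 (z : plane) : 0 <= cabs (f (cplx z)) by exact: cabs_ge0.
split.
  move=> w /inD[z Dz ->]; apply: cintegrable_bergman => //.
  exact: (integral_kernel_lty p1 q20 q12 u0 (B1 a1 a2) dab Dz mc F0 If).
have md := @measurable_disk R.
have mb := measurable_cabs (cmeasurable_bergman mf).
have ms := @measurable_edist_weight R a1 a2 p.
have int_pd (h : R[i] -> R[i]) : measurable_fun disk (fun z : plane => cabs (h (cplx z))) ->
  (\int[leb \x leb]_(z in disk) (cabs (h (cplx z)) `^ p * edist_weight a1 a2 p z)%:E =
   \int[leb \x leb]_(z in pdisk a1 a2) (cabs (h (cplx z)) `^ p * edist_weight a1 a2 p z)%:E)%E.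
  move=> mh; apply: integral_pdisk; last by move=> z; rewrite mulr_ge0 ?powR_ge0.
  by apply: measurable_funM; [exact: measurable_powR_comp|exact: measurable_funTS].
rewrite !int_pd//.
(* [schur_test] wants a function measurable on the whole plane, whereas f is measurable on the disk
   only. *)
pose F : plane -> R := (fun z => cabs (f (cplx z))) \_ disk.
have FE z : disk z -> F z = cabs (f (cplx z)).
  by move=> Dz; rewrite /F patchE mem_set.
have spd z : pdisk a1 a2 z -> disk z by case.
have mF : measurable_fun setT F by exact/(measurable_restrictT _ md).
have F0' z : 0 <= F z by rewrite /F patchE; case: ifP.
have := @schur_test R _ _ (@area R) (pdisk a1 a2) p kden_inv
  (testfun a1 a2 q1 u) (edist_weight a1 a2 p) F C1 C2 (measurable_pdisk a1 a2) p1
  measurable_kden_inv _ (measurable_testfun a1 a2 q1 u) _ ms _ mF F0' C10 C20 S1 S2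
  (fun w => cabs (bergman f (cplx w))) _ _ _.
rewrite (_ : (\int[leb \x leb]_(z in pdisk a1 a2) (F z `^ p * edist_weight a1 a2 p z)%:E)%E =
  (\int[leb \x leb]_(z in pdisk a1 a2) (cabs (f (cplx z)) `^ p * edist_weight a1 a2 p z)%:E)%E);
  last by apply: eq_integral => z; rewrite inE => /spd Dz; rewrite FE.
apply.
- by move=> x; exact: powR_ge0.
- by move=> z Dz; exact: testfun_gt0.
- by move=> z; exact: powR_ge0.
- exact: measurable_funS mb.
- by move=> w; exact: cabs_ge0.
- move=> w Dw; apply: le_trans (cabs_bergman_le mf w) _.
  rewrite (@integral_pdisk _ a1 a2); last 2 first.
  + apply: measurable_funM => //; apply: measurable_funTS.
    by apply: (measurableT_comp measurable_kden_inv); exact: measurable_pair1.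
  + by move=> z; rewrite mulr_ge0 ?powR_ge0.
  rewrite (eq_integral (fun z => (kden_inv (w, z) * F z)%:E))// => z.
  by rewrite inE => /spd Dz; rewrite FE.
Qed.

End WeightedBound.

Theorem proposition1p3 (R : realType) (p : R) (hp : 4 / 3 < p) (hp4 : p < 4) :
  (forall w2 : R[i], unit_disk w2 ->
     bergman_defined_on_Lp p (dist_weight p w2) /\
     bounded_on_Lp p (dist_weight p w2) bergman) /\
  (exists C : R, forall w2 : R[i], unit_disk w2 ->
     (operator_norm p (dist_weight p w2) bergman <= C%:E)%E).
Proof.
have [C C0 HC] := bergman_power_integral_le hp hp4.
have p0 : 0 < p by lra.
have pV0 : p^-1 != 0 by rewrite invr_eq0 gt_eqF.
have LpE a f : in_Lp p (dist_weight p a) f ->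
    cmeasurable_fun unit_disk f /\ (power_integral p a f < +oo)%E.
  by case=> mf; rewrite weighted_normE => /(lty_poweRy pV0).
have normle a f : unit_disk a -> in_Lp p (dist_weight p a) f ->
    (weighted_norm p (dist_weight p a) (bergman f) <=
     (C `^ p^-1)%:E * weighted_norm p (dist_weight p a) f)%E.
  move=> Da /LpE[mf If]; have [_ h] := HC a Da f mf If.
  rewrite !weighted_normE -poweR_EFin -poweRM ?lee_fin ?power_integral_ge0//.
  apply: gt0_ler_poweR => //.
  - by rewrite invr_ge0 ltW.
  - by rewrite in_itv/= leey power_integral_ge0.
  - by rewrite in_itv/= leey mule_ge0 ?lee_fin ?power_integral_ge0.
split=> [a Da|].
  split=> [f /LpE[mf If]|]; first by have [] := HC a Da f mf If.
  split; last by exists (C `^ p^-1) => f fLp; exact: normle.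
  move=> f fLp; have [mf If] := LpE _ _ fLp; split; first exact: cmeasurable_bergman.
  apply: le_lt_trans (normle a f Da fLp) _.
  by rewrite lte_mul_pinfty ?lee_fin ?powR_ge0//; case: fLp.
exists (C `^ p^-1) => a Da; apply: ge_ereal_sup => _ [f [fLp f1] <-].
apply: le_trans (normle a f Da fLp) _.
by rewrite -[leRHS]mule1 lee_wpmul2l// lee_fin powR_ge0.
Qed.
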